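(* Let $K\ge 0$ be an integer and let $(\mathbf{y}_t)_{t\ge 0}$ be the NN-$K$ iterates $$\mathbf{y}_{t+1}=\mathbf{y}_t-\epsilon\,\mathbf{D}_t^{-1/2}\sum_{k=0}^{K}\left(\mathbf{D}_t^{-1/2}\mathbf{B}\mathbf{D}_t^{-1/2}\right)^{k}\mathbf{D}_t^{-1/2}\mathbf{g}_t ,$$ started from an arbitrary $\mathbf{y}_0\in\mathbb{R}^{np}$ and run on the penalized objective $F$, with $\mathbf{g}_t,\mathbf{D}_t,\mathbf{B}$, the stepsize $\epsilon$ and the constants $\rho,\lambda,\Lambda,\zeta$ as defined in the context. Assume: (i) there are constants $0\le\delta\le\Delta<1$ with $\delta\le w_{ii}\le\Delta$ for all $i=1,\dots,n$; (ii) the functions $f_i:\mathbb{R}^p\to\mathbb{R}$ are twice differentiable and there are constants $0<m\le M<\infty$ with $m\mathbf{I}\preceq\nabla^2 f_i(\mathbf{x})\preceq M\mathbf{I}$ for all $\mathbf{x}\in\mathbb{R}^p$ and all $i$; (iii) $\|\nabla^2 f_i(\mathbf{x})-\nabla^2 f_i(\hat{\mathbf{x}})\|\le L\|\mathbf{x}-\hat{\mathbf{x}}\|$ for all $\mathbf{x},\hat{\mathbf{x}}\in\mathbb{R}^p$ and all $i$. Then for every $t\ge 1$, $$\left\|\mathbf{D}_t^{-1/2}\mathbf{g}_{t+1}\right\|\le\left(1-\epsilon+\epsilon\rho^{K+1}\right)\left[1+\Gamma_1(1-\zeta)^{\frac{t-1}{4}}\right]\left\|\mathbf{D}_{t-1}^{-1/2}\mathbf{g}_t\right\|+\epsilon^2\Gamma_2\left\|\mathbf{D}_{t-1}^{-1/2}\mathbf{g}_t\right\|^2,$$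 where $$\Gamma_1:=\frac{(\alpha\epsilon L\Lambda)^{1/2}(F(\mathbf{y}_0)-F(\mathbf{y}^* ))^{1/4}}{\lambda^{3/4}(2(1-\Delta)+\alpha m)},\qquad \Gamma_2:=\frac{\alpha L\Lambda^2}{2\lambda(2(1-\Delta)+\alpha m)^{1/2}} .$$
   Context: Network and weights. A connected, undirected (symmetric) network has $n$ agents $i=1,\dots,n$ with neighborhoods $\mathcal{N}_i$. The weight matrix $\mathbf{W}=(w_{ij})\in\mathbb{R}^{n\times n}$ has the sparsity pattern of the network ($w_{ij}=0$ if $j\ne i$ and $j\notin\mathcal{N}_i$), is symmetric and row stochastic (nonnegative entries, $\mathbf{W}\mathbf{1}=\mathbf{1}$), and satisfies $\mathrm{null}(\mathbf{I}-\mathbf{W})=\mathrm{span}(\mathbf{1})$. Set $\mathbf{Z}:=\mathbf{W}\otimes\mathbf{I}_p\in\mathbb{R}^{np\times np}$ and let $\mathbf{Z}_d:=\mathrm{diag}(\mathbf{Z})$ be the diagonal matrix with the same diagonal as $\mathbf{Z}$. Penalized objective. Each agent has a strongly convex local function $f_i:\mathbb{R}^p\to\mathbb{R}$. For $\mathbf{y}=[\mathbf{x}_1;\dots;\mathbf{x}_n]\in\mathbb{R}^{np}$ (stacked vectors $\mathbf{x}_i\in\mathbb{R}^p$) and a fixed $\alpha>0$, $$F(\mathbf{y}):=\tfrac12\,\mathbf{y}^T(\mathbf{I}-\mathbf{Z})\mathbf{y}+\alpha\sum_{i=1}^n f_i(\mathbf{x}_i),$$ and $\mathbf{y}^*:=\arg\min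 F$. Quantities at the iterate $\mathbf{y}_t=[\mathbf{x}_{1,t};\dots;\mathbf{x}_{n,t}]$. Gradient: $\mathbf{g}_t:=\nabla F(\mathbf{y}_t)=(\mathbf{I}-\mathbf{Z})\mathbf{y}_t+\alpha[\nabla f_1(\mathbf{x}_{1,t});\dots;\nabla f_n(\mathbf{x}_{n,t})]$. Let $\mathbf{G}_t\in\mathbb{R}^{np\times np}$ be block diagonal with $i$-th $p\times p$ diagonal block $\nabla^2 f_i(\mathbf{x}_{i,t})$. Then $$\mathbf{D}_t:=\alpha\mathbf{G}_t+2(\mathbf{I}-\mathbf{Z}_d),\qquad \mathbf{B}:=\mathbf{I}-2\mathbf{Z}_d+\mathbf{Z},$$ so that the Hessian is $\nabla^2F(\mathbf{y}_t)=\mathbf{I}-\mathbf{Z}+\alpha\mathbf{G}_t=\mathbf{D}_t-\mathbf{B}$. The matrix $\mathbf{D}_t$ is positive definite. Constants (with $\delta,\Delta,m,M,L$ as in the hypotheses): $$\rho:=\frac{2(1-\delta)}{2(1-\delta)+\alpha m},\qquad \lambda:=\frac{1}{2(1-\delta)+\alpha M},\qquad \Lambda:=\frac{1-\rho^{K+1}}{(1-\rho)(2(1-\Delta)+\alpha m)} .$$ Stepsize: $$\epsilon:=\min\left\{1,\left[\frac{3m\lambda^{5/2}}{L\Lambda^{3}(F(\mathbf{y}_0)-F(\mathbf{y}^* ))^{1/2}}\right]^{1/2}\right\},$$ where the second entry is read as $+\infty$ if its denominator vanishes. Further, $0<\zeta<1$ is given by $$\zeta:=(2-\epsilon)\epsilon\alpha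 m\lambda-\frac{\alpha\epsilon^3L\Lambda^3(F(\mathbf{y}_0)-F(\mathbf{y}^* ))^{1/2}}{6\lambda^{3/2}} .$$ Norms are Euclidean norms of vectors and the induced spectral norms of matrices. *)

(* Defs.v *)
From HB Require Import structures.
From mathcomp Require Import all_boot all_order all_algebra.
From mathcomp Require Import all_classical all_reals all_analysis.
From mathcomp Require Import mxtens.

Set Implicit Arguments.
Unset Strict Implicit.
Unset Printing Implicit Defensive.

Import Order.TTheory GRing.Theory Num.Theory.
Import numFieldNormedType.Exports.

Local Open Scope classical_set_scope.
Local Open Scope ring_scope.

(* The norm `|_| that MathComp-Analysis puts on matrices is the max norm, hence
   the Euclidean and spectral norms below; the topology, and so
   differentiability, is the same. *)
Definition enorm (R : realType) (d : nat) (v : 'cV[R]_d) : R :=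
  Num.sqrt (\sum_(i < d) v i 0 ^+ 2).

Definition specnorm (R : realType) (d : nat) (A : 'M[R]_d) : R :=
  sup [set enorm (A *m v) | v in [set v : 'cV[R]_d | enorm v <= 1]].

Definition psdmx (R : realType) (d : nat) (A : 'M[R]_d) : Prop :=
  A^T = A /\ forall v : 'cV[R]_d, 0 <= (v^T *m A *m v) 0 0.

Definition loewner (R : realType) (d : nat) (A B : 'M[R]_d) : Prop :=
  psdmx (B - A).

(* The positive semidefinite square root, unique when it exists, i.e. when A is
   itself positive semidefinite (junk value 0 otherwise). *)
Definition sqrtmx (R : realType) (d : nat) (A : 'M[R]_d) : 'M[R]_d :=
  xget 0 [set S : 'M[R]_d | psdmx S /\ S *m S = A].

Definition invsqrtmx (R : realType) (d : nat) (A : 'M[R]_d) : 'M[R]_d :=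
  invmx (sqrtmx A).

Definition grad (R : realType) (d : nat) (f : 'cV[R]_d -> R) (x : 'cV[R]_d) :
    'cV[R]_d :=
  \col_i 'D_(delta_mx i 0) f x.

Definition hessian (R : realType) (d : nat) (f : 'cV[R]_d -> R)
    (x : 'cV[R]_d) : 'M[R]_d :=
  \matrix_(i, j) 'D_(delta_mx i 0) ('D_(delta_mx j 0) f) x.

Definition twice_differentiable (R : realType) (d : nat)
    (f : 'cV[R]_d -> R) : Prop :=
  (forall x, differentiable f x) /\ (forall x, differentiable (grad f) x).

Definition strongly_convex (R : realType) (d : nat)
    (f : 'cV[R]_d -> R) : Prop :=
  exists2 mu : R, 0 < mu &
    forall (x y : 'cV[R]_d) (s : R), 0 <= s <= 1 ->
      f (s *: x + (1 - s) *: y) <=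
        s * f x + (1 - s) * f y
        - mu / 2 * s * (1 - s) * enorm (x - y) ^+ 2.

(* [N i] is the neighborhood of agent i; whether i \in N i is immaterial. *)
Definition connected_network (n : nat) (N : 'I_n -> {set 'I_n}) : Prop :=
  (forall i j, (j \in N i) = (i \in N j)) /\
  (forall i j, fingraph.connect [rel k l | l \in N k] i j).

Definition network_weights (R : realType) (n : nat) (N : 'I_n -> {set 'I_n})
    (W : 'M[R]_n) : Prop :=
  [/\ forall i j, j != i -> j \notin N i -> W i j = 0,
      W^T = W,
      forall i j, 0 <= W i j,
      W *m (const_mx 1 : 'cV[R]_n) = const_mx 1 &
      [set v : 'cV[R]_n | (1%:M - W) *m v = 0] =
        [set c *: (const_mx 1 : 'cV[R]_n) | c in [set: R]]].

(* R^(np) is 'cV_(n * p); coordinate a of block i has index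
   [mxtens_index (i, a)], the convention of the Kronecker product [tensmx]. *)
Definition block (R : realType) (n p : nat) (y : 'cV[R]_(n * p)) (i : 'I_n) :
    'cV[R]_p :=
  \col_a y (mxtens_index (i, a)) 0.

Definition blockdiag (R : realType) (n p : nat) (A : 'I_n -> 'M[R]_p) :
    'M[R]_(n * p) :=
  \matrix_(k, l) (let: (i, a) := mxtens_unindex k in
                  let: (j, b) := mxtens_unindex l in
                  if i == j then A i a b else 0).

Definition Zmx (R : realType) (n p : nat) (W : 'M[R]_n) : 'M[R]_(n * p) :=
  tensmx W (1%:M : 'M[R]_p).

Definition Zdmx (R : realType) (n p : nat) (W : 'M[R]_n) : 'M[R]_(n * p) :=
  diag_mx (\row_k Zmx p W k k).

Definition Fobj (R : realType) (n p : nat) (W : 'M[R]_n) (alpha : R)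
    (f : 'I_n -> 'cV[R]_p -> R) (y : 'cV[R]_(n * p)) : R :=
  2^-1 * (y^T *m (1%:M - Zmx p W) *m y) 0 0
  + alpha * \sum_(i < n) f i (block y i).

Definition Gmx (R : realType) (n p : nat) (f : 'I_n -> 'cV[R]_p -> R)
    (y : 'cV[R]_(n * p)) : 'M[R]_(n * p) :=
  blockdiag (fun i => hessian (f i) (block y i)).

Definition Dmx (R : realType) (n p : nat) (W : 'M[R]_n) (alpha : R)
    (f : 'I_n -> 'cV[R]_p -> R) (y : 'cV[R]_(n * p)) : 'M[R]_(n * p) :=
  alpha *: Gmx f y + 2 *: (1%:M - Zdmx p W).

Definition Bmx (R : realType) (n p : nat) (W : 'M[R]_n) : 'M[R]_(n * p) :=
  1%:M - 2 *: Zdmx p W + Zmx p W.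

(* The approximate inverse Hessian of NN-K at y. *)
Definition NNinv (R : realType) (n p : nat) (W : 'M[R]_n) (alpha : R)
    (f : 'I_n -> 'cV[R]_p -> R) (K : nat) (y : 'cV[R]_(n * p)) :
    'M[R]_(n * p) :=
  let Dm := invsqrtmx (Dmx W alpha f y) in
  Dm *m (\sum_(0 <= k < K.+1) (Dm *m Bmx p W *m Dm) ^+ k) *m Dm.

(* [gap] stands for F(y_0) - F(y^* ). *)
Definition stepsize (R : realType) (m L lambda Lambda gap : R) : R :=
  let den := L * Lambda ^+ 3 * gap `^ (1 / 2) in
  if den == 0 then 1
  else Num.min 1 ((3 * m * lambda `^ (5 / 2) / den) `^ (1 / 2)).

(* Main.v *)
(* Let X = D_t^{-1/2} B D_t^{-1/2}, so that 0 <= X <= rho, and w = D_t^{-1/2}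
   g_t. Telescoping the truncated Neumann series turns D_t^{-1/2} (g_t + H_t
   (y_{t+1} - y_t)) into ((1 - eps) I + eps X^{K+1}) w, and the Lipschitz
   Hessian bounds the rest of g_{t+1}. The norms of D_t^{-1/2} g_t and
   D_{t-1}^{-1/2} g_t are compared through D_{t-1} <= (1 + eta) D_t with eta
   = alpha L |y_t - y_{t-1}| / (2 (1 - Delta) + alpha m), so that a decay
   rate of gap_t = F(y_t) - F(y^* ) is needed.

   Since |g_t|^2 <= (2 / lambda) gap_t, the cubic Taylor remainder alone
   yields a contraction of gap_t in which the constant 1/6 of zeta is
   multiplied by 2^{3/2}. The remainder is therefore bounded also by the
   total variation alpha (M - m) of the Hessian. The geometric mean of the
   two bounds gives gap_{t+1} <= sigma gap_t with sigma^2 <= 1 - zeta, which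
   suffices when Gamma1 is bounded, because eta may then be compared with the
   linear term 2 Gamma1 (1 - zeta)^{(t-1)/4} of the square of the claimed
   factor. When Gamma1 is large, eps is small and sigma <= 1 - zeta. *)

Require Import Defs.
From HB Require Import structures.
From mathcomp Require Import all_boot all_order all_algebra.
From mathcomp Require Import all_classical all_reals all_analysis.
From mathcomp Require Import mxtens complex ring lra.
Set Implicit Arguments.
Unset Strict Implicit.
Unset Printing Implicit Defensive.
Import Order.TTheory GRing.Theory Num.Theory.
Import numFieldNormedType.Exports.
Local Open Scope ring_scope.

(** * Euclidean inner product and semidefinite quadratic forms *)

Definition dot (R : realType) (d : nat) (u v : 'cV[R]_d) : R :=
  \sum_(i < d) u i 0 * v i 0.

Section Dot.
Context {R : realType} {d : nat}.
Implicit Types (u v w : 'cV[R]_d) (A : 'M[R]_d) (a k : R).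

Lemma dotC u v : dot u v = dot v u.
Proof. by apply: eq_bigr => i _; rewrite mulrC. Qed.

Lemma dotDr u v w : dot u (v + w) = dot u v + dot u w.
Proof. by rewrite -big_split; apply: eq_bigr => i _; rewrite mxE mulrDr. Qed.

Lemma dotZr a u v : dot u (a *: v) = a * dot u v.
Proof. by rewrite mulr_sumr; apply: eq_bigr => i _; rewrite mxE mulrCA. Qed.

Lemma dotNr u v : dot u (- v) = - dot u v.
Proof. by rewrite -scaleN1r dotZr mulN1r. Qed.

Lemma dotBr u v w : dot u (v - w) = dot u v - dot u w.
Proof. by rewrite dotDr dotNr. Qed.

Lemma dotDl u v w : dot (u + v) w = dot u w + dot v w.
Proof. by rewrite !(dotC _ w) dotDr. Qed.

Lemma dotZl a u v : dot (a *: u) v = a * dot u v.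
Proof. by rewrite !(dotC _ v) dotZr. Qed.

Lemma dotNl u v : dot (- u) v = - dot u v.
Proof. by rewrite !(dotC _ v) dotNr. Qed.

Lemma dot0r u : dot u 0 = 0.
Proof. by rewrite -(scale0r 0) dotZr mul0r. Qed.

Lemma dot_ge0 v : 0 <= dot v v.
Proof. by apply: sumr_ge0 => i _; rewrite -expr2 sqr_ge0. Qed.

Lemma dotE u v : dot u v = (u^T *m v) 0 0.
Proof. by rewrite mxE; apply: eq_bigr => i _; rewrite mxE. Qed.

Lemma dot_mulmxE u A v : (u^T *m A *m v) 0 0 = dot u (A *m v).
Proof. by rewrite dotE mulmxA. Qed.

Lemma dot_mulmx u A v : dot u (A *m v) = dot (A^T *m u) v.
Proof. by rewrite !dotE trmx_mul trmxK mulmxA. Qed.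

Lemma dot_sym u A v : A^T = A -> dot u (A *m v) = dot (A *m u) v.
Proof. by move=> AT; rewrite dot_mulmx AT. Qed.

Lemma sqr_enorm v : enorm v ^+ 2 = dot v v.
Proof.
rewrite sqr_sqrtr; last by apply: sumr_ge0 => i _; rewrite sqr_ge0.
by apply: eq_bigr => i _; rewrite expr2.
Qed.

Lemma enorm_ge0 v : 0 <= enorm v.
Proof. exact: sqrtr_ge0. Qed.

Lemma enormE v : enorm v = Num.sqrt (dot v v).
Proof. by rewrite -sqr_enorm sqrtr_sqr ger0_norm // enorm_ge0. Qed.

Lemma enormZ a v : enorm (a *: v) = `|a| * enorm v.
Proof.
rewrite !enormE dotZl dotZr mulrA -expr2 sqrtrM ?sqr_ge0 //.
by rewrite sqrtr_sqr.
Qed.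

Lemma enorm_le v a : 0 <= a -> dot v v <= a ^+ 2 -> enorm v <= a.
Proof.
by move=> a0 h; rewrite -(ger0_norm a0) -sqrtr_sqr enormE ler_wsqrtr.
Qed.

(** The form is nonnegative on every [a *: u + b *: v], so its discriminant is at most zero. The
    coefficients [(y, - z)] or [(- z, x)] give this when [y] or [x] is positive. If both vanish, the
    coefficients [(1, 1)] and [(1, - 1)] force [z = 0]. *)
Lemma dot_psd_CS A u v : A^T = A -> (forall w, 0 <= dot w (A *m w)) ->
  dot u (A *m v) ^+ 2 <= dot u (A *m u) * dot v (A *m v).
Proof.
move=> AT Apsd.
have q a b : 0 <= a ^+ 2 * dot u (A *m u) + 2 * a * b * dot u (A *m v)
                  + b ^+ 2 * dot v (A *m v).
  have := Apsd (a *: u + b *: v).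
  rewrite mulmxDr -!scalemxAr !(dotDl, dotDr, dotZl, dotZr).
  have -> : dot v (A *m u) = dot u (A *m v) by rewrite dot_sym // dotC.
  by lra.
move: (Apsd u) (Apsd v) q.
move: (dot u _) (dot v _) (dot u (A *m v)) => x y z x0 y0 q.
have [y_gt0|] := ltrP 0 y.
  by have := q y (- z) => h; rewrite -(ler_pM2l y_gt0); lra.
have [x_gt0 y_le0|x_le0 y_le0] := ltrP 0 x.
  by have := q (- z) x => h; rewrite -(ler_pM2l x_gt0); lra.
have -> : x = 0 by lra.
have -> : y = 0 by lra.
by have := q 1 1; have := q 1 (- 1) => h1 h2; have -> : z = 0 by lra.
Qed.

Lemma dot_CS u v : dot u v ^+ 2 <= dot u u * dot v v.
Proof.
have := @dot_psd_CS 1%:M u v (trmx1 _ _); rewrite !mul1mx; apply => w.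
by rewrite mul1mx dot_ge0.
Qed.

Lemma dot_le_enorm u v : dot u v <= enorm u * enorm v.
Proof.
apply: le_trans (ler_norm _) _.
rewrite -ler_sqr ?nnegrE ?mulr_ge0 ?enorm_ge0 // exprMn !sqr_enorm.
by rewrite real_normK ?num_real // dot_CS.
Qed.

Lemma enormD u v : enorm (u + v) <= enorm u + enorm v.
Proof.
apply: enorm_le; first by rewrite addr_ge0 ?enorm_ge0.
rewrite !(dotDl, dotDr) (dotC v u) sqrrD !sqr_enorm.
by have := dot_le_enorm u v; lra.
Qed.

(** A form of [A ^+ 2 <= k *: A]: the previous Cauchy-Schwarz inequality for the pair [A *m v], [v]
    bounds the square of the left side by [k] times the product of the two forms, and one factor is
    divided out. *)
Lemma sqr_enorm_mulmx_psd A k v : A^T = A ->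
  (forall w, 0 <= dot w (A *m w)) -> 0 <= k ->
  (forall w, dot w (A *m w) <= k * dot w w) ->
  dot (A *m v) (A *m v) <= k * dot v (A *m v).
Proof.
move=> AT Apsd k0 Ak; have := @dot_psd_CS A (A *m v) v AT Apsd.
have := Ak (A *m v); have := dot_ge0 (A *m v); have := Apsd v.
move: (dot _ _) (dot v _) (dot _ (A *m (A *m v))) => x y z y0.
rewrite le_eqVlt => /orP[/eqP<- _ _|x0 zx xzy]; first by rewrite mulr_ge0.
have : x ^+ 2 <= k * x * y by apply: le_trans xzy _; rewrite ler_wpM2r.
by rewrite expr2 -mulrA mulrCA ler_pM2l.
Qed.

End Dot.

(** * Truncated Neumann series of a symmetric matrix between 0 and rho *)

Section NeumannSum.
Context {R : realType} {d : nat}.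
Variables (X : 'M[R]_d) (rho : R) (K : nat).
Hypotheses (XT : X^T = X) (rho_ge0 : 0 <= rho)
  (X_psd : forall v, 0 <= dot v (X *m v))
  (X_le : forall v, dot v (X *m v) <= rho * dot v v).
Implicit Types v w : 'cV[R]_d.

Let P : 'M[R]_d := \sum_(0 <= k < K.+1) X ^+ k.

Lemma mulmx_exprS k v : X ^+ k.+1 *m v = X ^+ k *m (X *m v).
Proof. by rewrite exprSr mulmxA. Qed.

Lemma mulmx_exprSl k v : X ^+ k.+1 *m v = X *m (X ^+ k *m v).
Proof. by rewrite exprS mulmxA. Qed.

Lemma trmx_exp k : (X ^+ k)^T = X ^+ k.
Proof.
elim: k => [|k IH]; first by rewrite expr0 trmx1.
by rewrite exprS trmx_mul IH XT -[RHS]exprS exprSr.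
Qed.

(** The induction goes down by two: the form of [X ^+ k.+2] at [v] is the form of [X ^+ k] at
    [X *m v], which leaves the exponents 0 and 1. *)
Lemma dot_exp_psd k v : 0 <= dot v (X ^+ k *m v).
Proof.
elim/ltn_ind: k v => -[_ v|[_ v|k IH v]].
- by rewrite mul1mx dot_ge0.
- by rewrite expr1.
- by rewrite mulmx_exprSl mulmx_exprS dot_sym // IH // ltnS ltnW.
Qed.

Lemma sqr_mulmx_le v : dot (X *m v) (X *m v) <= rho ^+ 2 * dot v v.
Proof.
apply: le_trans (@sqr_enorm_mulmx_psd _ _ _ _ _ XT X_psd rho_ge0 X_le) _.
by rewrite expr2 -mulrA ler_wpM2l.
Qed.

Lemma enorm_exp_le k v : enorm (X ^+ k *m v) <= rho ^+ k * enorm v.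
Proof.
elim: k => [|k IH]; first by rewrite expr0 mul1mx mul1r.
rewrite mulmx_exprSl.
have : enorm (X *m (X ^+ k *m v)) <= rho * enorm (X ^+ k *m v).
  apply: enorm_le; first by rewrite mulr_ge0 ?enorm_ge0.
  by rewrite exprMn sqr_enorm sqr_mulmx_le.
by move=> /le_trans; apply; rewrite exprS -mulrA ler_wpM2l.
Qed.

Lemma dot_exp_le k v : dot v (X ^+ k *m v) <= rho ^+ k * dot v v.
Proof.
apply: le_trans (dot_le_enorm _ _) _.
rewrite -sqr_enorm expr2 mulrCA ler_wpM2l ?enorm_ge0 //.
exact: enorm_exp_le.
Qed.

Lemma neumannE v : P *m v = \sum_(0 <= k < K.+1) X ^+ k *m v.
Proof. by rewrite mulmx_suml. Qed.

Lemma dot_neumann v : dot v (P *m v) = \sum_(0 <= k < K.+1) dot v (X ^+ k *m v).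
Proof.
rewrite neumannE; elim: (index_iota _ _) => [|k s IH].
  by rewrite !big_nil dot0r.
by rewrite !big_cons dotDr IH.
Qed.

Lemma neumannT : P^T = P.
Proof. by rewrite linear_sum; apply: eq_bigr => k _; exact: trmx_exp. Qed.

Lemma neumann_ge v : dot v v <= dot v (P *m v).
Proof.
rewrite dot_neumann big_nat_recl // expr0 mul1mx lerDl.
by apply: sumr_ge0 => k _; exact: dot_exp_psd.
Qed.

Lemma neumann_le v :
  dot v (P *m v) <= (\sum_(0 <= k < K.+1) rho ^+ k) * dot v v.
Proof.
by rewrite dot_neumann mulr_suml; apply: ler_sum => k _; exact: dot_exp_le.
Qed.

Lemma neumann_telescope v : P *m v - X *m (P *m v) = v - X ^+ K.+1 *m v.
Proof.
rewrite neumannE mulmx_sumr -sumrB.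
have -> : \sum_(0 <= k < K.+1) (X ^+ k *m v - X *m (X ^+ k *m v)) =
   - \sum_(0 <= k < K.+1) (X ^+ k.+1 *m v - X ^+ k *m v).
  by rewrite -sumrN; apply: eq_bigr => k _; rewrite opprB mulmx_exprSl.
by rewrite telescope_sumr // opprB expr0 mul1mx.
Qed.

(** [P] is a polynomial in [X], so its product with [X ^+ K.+1] is a sum of powers of [X], each of
    them semidefinite. *)
Lemma neumann_tail_psd v : 0 <= dot (P *m v) (X ^+ K.+1 *m v).
Proof.
rewrite dotC neumannE; elim: (index_iota _ _) => [|k s IH].
  by rewrite big_nil dot0r.
rewrite big_cons dotDr addr_ge0 //.
rewrite -dot_sym ?trmx_exp // mulmxA.
have -> : X ^+ K.+1 *m X ^+ k = X ^+ (K.+1 + k) by rewrite exprD.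
exact: dot_exp_psd.
Qed.

End NeumannSum.

(** * Norms scaled by the inverse of a symmetric square root *)

Section Factorization.
Context {R : realType} {d : nat}.
Variables (S D : 'M[R]_d) (c lam : R).
Hypotheses (ST : S^T = S) (SU : S \in unitmx) (SS : S *m S = D).
Hypotheses (c_gt0 : 0 < c)
  (D_ge : forall v, c * dot v v <= dot v (D *m v))
  (D_le : forall v, lam * dot v (D *m v) <= dot v v).
Implicit Types v g : 'cV[R]_d.

Lemma invmx_sym : (invmx S)^T = invmx S.
Proof. by rewrite trmx_inv ST. Qed.

Lemma dot_fact v : dot v (D *m v) = dot (S *m v) (S *m v).
Proof. by rewrite -SS -mulmxA dot_sym. Qed.

Lemma dot_fact_invmx v : dot (invmx S *m v) (D *m (invmx S *m v)) = dot v v.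
Proof. by rewrite dot_fact mulKVmx. Qed.

Lemma enorm_invmx_sqr_le g : c * dot (invmx S *m g) (invmx S *m g) <= dot g g.
Proof. by rewrite -[leRHS]dot_fact_invmx. Qed.

Lemma enorm_invmx_sqr_ge g : lam * dot g g <= dot (invmx S *m g) (invmx S *m g).
Proof. by rewrite -[in leLHS](dot_fact_invmx g). Qed.

(** Inversion reverses the Loewner order. With [u] the solution of [D *m u = g], the number
    [dot w w] is the product of [g] and [u], hence of [invmx S' *m g] and [S' *m u]. Cauchy-Schwarz
    and the comparison of [D'] with [D] at [u] bound its square, and one factor [dot w w]
    cancels. *)
Lemma invmx_compare (S' D' : 'M[R]_d) k g : S'^T = S' -> S' \in unitmx ->
    S' *m S' = D' -> 0 <= k ->
    (forall v, dot v (D' *m v) <= k * dot v (D *m v)) ->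
  dot (invmx S *m g) (invmx S *m g) <=
  k * dot (invmx S' *m g) (invmx S' *m g).
Proof.
move=> S'T S'U S'S' k0 D'D; set w := invmx S *m g; set u := invmx S *m w.
have xE : dot w w = dot (invmx S' *m g) (S' *m u).
  by rewrite dot_sym // mulKVmx // [RHS]dot_sym ?invmx_sym.
have uD : dot u (D *m u) = dot w w by rewrite dot_fact_invmx.
have := D'D u; rewrite uD -S'S' -mulmxA dot_sym // => le1.
have := dot_CS (invmx S' *m g) (S' *m u); rewrite -xE.
move: (dot_ge0 w) (dot_ge0 (invmx S' *m g)) le1; move: (dot w w) => x.
rewrite le_eqVlt => /orP[/eqP<- y0 _ _|x0 y0 le1 le2].
  by rewrite mulr_ge0.
rewrite -(ler_pM2l x0) -expr2; apply: le_trans le2 _.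
by rewrite mulrCA [leRHS]mulrCA mulrC; nra.
Qed.

End Factorization.

(** * The NN-K approximate inverse Hessian *)

Section ApproxNewton.
Context {R : realType} {d : nat}.
Variables (S D B : 'M[R]_d) (c lam rho : R) (K : nat).
Hypotheses (ST : S^T = S) (SU : S \in unitmx) (SS : S *m S = D).
Hypotheses (c_gt0 : 0 < c)
  (D_ge : forall v, c * dot v v <= dot v (D *m v))
  (D_le : forall v, lam * dot v (D *m v) <= dot v v).
Hypotheses (BT : B^T = B) (rho_ge0 : 0 <= rho)
  (B_psd : forall v, 0 <= dot v (B *m v))
  (B_le : forall v, dot v (B *m v) <= rho * dot v (D *m v)).
Implicit Types v g : 'cV[R]_d.

Let T : 'M[R]_d := invmx S.
Let X := T *m B *m T.
Let P : 'M[R]_d := \sum_(0 <= k < K.+1) X ^+ k.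
Let Hi := T *m P *m T.
(** The constant Lambda of the theorem, with its geometric quotient kept as a sum. *)
Let Lam := (\sum_(0 <= k < K.+1) rho ^+ k) / c.
Let s g := dot g (Hi *m g).

Let TT : T^T = T. Proof. exact: invmx_sym. Qed.

Let XT : X^T = X.
Proof. by rewrite /X !trmx_mul TT BT mulmxA. Qed.

Let dotX v : dot v (X *m v) = dot (T *m v) (B *m (T *m v)).
Proof. by rewrite /X -!mulmxA [LHS]dot_sym. Qed.

Let X_psd v : 0 <= dot v (X *m v). Proof. by rewrite dotX. Qed.

Let X_le v : dot v (X *m v) <= rho * dot v v.
Proof. by rewrite dotX -[in leRHS](@dot_fact_invmx _ _ S D). Qed.

Let Hi_sym : Hi^T = Hi.
Proof. by rewrite /Hi !trmx_mul TT neumannT ?mulmxA. Qed.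

Let sE g : s g = dot (T *m g) (P *m (T *m g)).
Proof. by rewrite /s /Hi -!mulmxA [LHS]dot_sym. Qed.

Lemma dot_NN_ge g : lam * dot g g <= dot g (Hi *m g).
Proof.
rewrite -/(s g) sE; apply: le_trans (neumann_ge _ XT X_psd _).
exact: (enorm_invmx_sqr_ge ST SU SS D_le).
Qed.

Let Lam_ge0 : 0 <= Lam.
Proof.
by rewrite divr_ge0 ?(ltW c_gt0) ?sumr_ge0 // => k _; rewrite exprn_ge0.
Qed.

Lemma dot_NN_le g : dot g (Hi *m g) <= Lam * dot g g.
Proof.
rewrite -/(s g) sE; apply: le_trans (neumann_le _ XT rho_ge0 X_psd X_le _) _.
rewrite /Lam -mulrA ler_wpM2l //.
  by rewrite sumr_ge0 // => k _; rewrite exprn_ge0.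
by rewrite mulrC ler_pdivlMr // mulrC (enorm_invmx_sqr_le ST SU SS D_ge).
Qed.

Lemma dot_NN_psd g : 0 <= dot g (Hi *m g).
Proof.
rewrite -/(s g) sE; apply: le_trans (neumann_ge _ XT X_psd _).
exact: dot_ge0.
Qed.

Lemma NN_sqr_le g : enorm (Hi *m g) ^+ 2 <= Lam * dot g (Hi *m g).
Proof.
rewrite sqr_enorm; apply: sqr_enorm_mulmx_psd => //; first exact: dot_NN_psd.
exact: dot_NN_le.
Qed.

Lemma NN_le g : enorm (Hi *m g) <= Lam * enorm g.
Proof.
apply: enorm_le; first by rewrite mulr_ge0 ?enorm_ge0.
rewrite -sqr_enorm; apply: le_trans (NN_sqr_le g) _.
by rewrite exprMn sqr_enorm expr2 -mulrA ler_wpM2l // dot_NN_le.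
Qed.

(** Conjugation by [T] turns [D] into the identity and [B] into [X], so the telescoped identity for
    [P] applies. *)
Let hessian_NN g : T *m ((D - B) *m (Hi *m g)) =
  T *m g - X ^+ K.+1 *m (T *m g).
Proof.
rewrite -(neumann_telescope X K) -/P.
have -> : Hi *m g = T *m (P *m (T *m g)) by rewrite /Hi -!mulmxA.
rewrite mulmxBl -SS mulmxBr -!mulmxA; congr (_ - _).
by rewrite !mulmxA mulVmx // mul1mx mulmxV // mul1mx.
Qed.

(** The truncated series underestimates the inverse of [D - B]: by [hessian_NN], the two sides
    differ by the form treated in [neumann_tail_psd]. This bounds the second-order term of a step by
    [dot g (Hi *m g)]. *)
Lemma hessian_NN_le g :
  dot (Hi *m g) ((D - B) *m (Hi *m g)) <= dot g (Hi *m g).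
Proof.
have -> : dot (Hi *m g) ((D - B) *m (Hi *m g)) =
          dot (P *m (T *m g)) (T *m ((D - B) *m (Hi *m g))).
  by rewrite [RHS]dot_sym // /Hi -!mulmxA.
rewrite hessian_NN -/(s g) sE dotBr dotC gerBl.
exact: neumann_tail_psd.
Qed.

Lemma NN_contraction eps g : 0 <= eps <= 1 ->
  enorm (T *m (g - eps *: ((D - B) *m (Hi *m g)))) <=
  (1 - eps + eps * rho ^+ K.+1) * enorm (T *m g).
Proof.
move=> /andP[e0 e1]; rewrite mulmxBr -scalemxAr hessian_NN.
have -> : T *m g - eps *: (T *m g - X ^+ K.+1 *m (T *m g)) =
  (1 - eps) *: (T *m g) + eps *: (X ^+ K.+1 *m (T *m g)).
  by rewrite scalerBr scalerBl scale1r opprB addrA addrAC -addrA.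
apply: le_trans (enormD _ _) _.
rewrite !enormZ !ger0_norm ?subr_ge0 // [leRHS]mulrDl lerD2l -mulrA.
rewrite ler_wpM2l //.
exact: enorm_exp_le.
Qed.

End ApproxNewton.

(** * Taylor bounds on a line, directional derivatives and the spectral norm *)

Section Calculus.
Context {R : realType}.
Local Open Scope classical_set_scope.

(** Subtracting from [h] a primitive of the polynomial leaves a function with nonpositive derivative
    on the unit interval. The mean value theorem takes the place of an integral remainder. *)
Lemma le_polynomial_derive (h dh : R -> R) (a b c : R) :
    (forall t : R, is_derive t (1 : R) h (dh t)) ->
    (forall t, 0 <= t <= 1 -> dh t <= a + b * t + c * t ^+ 2) ->
  forall t, 0 <= t <= 1 -> h t <= h 0 + a * t + b / 2 * t ^+ 2 + c / 3 * t ^+ 3.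
Proof.
move=> h_dh dh_le t /andP[t0 t1].
pose k : R -> R := h - (a *: id + (b / 2) *: id ^+ 2 + (c / 3) *: id ^+ 3).
have kE x : k x = h x - (a * x + b / 2 * x ^+ 2 + c / 3 * x ^+ 3) by [].
have k_dk (x : R) : is_derive x (1 : R) k (dh x - (a + b * x + c * x ^+ 2)).
  have dX (n : nat) : is_derive x (1 : R) (id ^+ n.+1) (n.+1%:R * x ^+ n).
    by apply: is_derive_eq (is_deriveX n.+1 (is_derive_id x 1)) _; exact: mulr1.
  have dp := is_deriveD (is_deriveD (is_deriveZ a (dX 0))
    (is_deriveZ (b / 2) (dX 1))) (is_deriveZ (c / 3) (dX 2)).
  apply: is_derive_eq (is_deriveB (h_dh x) dp) _.
  by rewrite /GRing.scale /=; lra.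
have k_cont : {within `[0, t], continuous k}.
  apply: continuous_subspaceT => x.
  exact/differentiable_continuous/derivable1_diffP.
have [x] := MVT_segment t0 (fun x _ => k_dk x) k_cont.
rewrite in_itv /= => /andP[x0 xt] E.
have x1 : 0 <= x <= 1 by rewrite x0 (le_trans xt).
move: E; rewrite !kE !expr0n /= => E.
have : (dh x - (a + b * x + c * x ^+ 2)) * (t - 0) <= 0.
    by rewrite mulr_le0_ge0 ?subr_ge0 // subr_le0 dh_le.
by rewrite -E; lra.
Qed.

Lemma taylor2_le (phi psi chi : R -> R) (a b : R) :
    (forall t : R, is_derive t (1 : R) phi (psi t)) ->
    (forall t : R, is_derive t (1 : R) psi (chi t)) ->
    (forall t, 0 <= t <= 1 -> chi t <= a + b * t) ->
  phi 1 <= phi 0 + psi 0 + a / 2 + b / 6.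
Proof.
move=> phi' psi' chi_le.
have psi_le t : 0 <= t <= 1 -> psi t <= psi 0 + a * t + b / 2 * t ^+ 2.
  move=> t01; have := @le_polynomial_derive psi chi a b 0 psi' _ t t01.
  by move=> h; apply: le_trans (h _) _ => [u /chi_le|]; lra.
have := @le_polynomial_derive phi psi _ _ _ phi' psi_le 1.
by rewrite ler01 lexx => /(_ isT); lra.
Qed.

Lemma taylor1_le (psi chi : R -> R) (a b : R) :
    (forall t : R, is_derive t (1 : R) psi (chi t)) ->
    (forall t, 0 <= t <= 1 -> chi t <= a + b * t) ->
  psi 1 <= psi 0 + a + b / 2.
Proof.
move=> psi' chi_le; have := @le_polynomial_derive psi chi a b 0 psi' _ 1.
rewrite ler01 lexx => h.
by apply: le_trans (h _ isT) _ => [u /chi_le|]; lra.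
Qed.

(** The two difference quotients are the same function, so derivatives at a point in direction [d]
    and derivatives along the line can be exchanged freely. *)
Lemma is_derive_line (V : normedModType R) (f : V -> R) (x d : V) (t l : R) :
  is_derive (x + t *: d) d f l <->
  is_derive t (1 : R) (fun u => f (x + u *: d)) l.
Proof.
have E : (fun h : R => h^-1 *: ((f \o shift (x + t *: d)) (h *: d)
                                 - f (x + t *: d))) =
  (fun h : R => h^-1 *: (((fun u => f (x + u *: d)) \o shift t) (h *: 1)
                         - f (x + t *: d))).
  apply/funext => h /=; congr (_ *: (f _ - _)).
  by rewrite [h *: 1]mulr1 scalerDl addrCA.
split=> -[dv vl]; split.
- by move: dv; rewrite /derivable E.
- by move: vl; rewrite /derive E.
- by move: dv; rewrite /derivable -E.
- by move: vl; rewrite /derive -E.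
Qed.

Variable p : nat.
Implicit Types (f : 'cV[R]_p -> R) (x d v : 'cV[R]_p).

Lemma cV_sum_delta d : d = \sum_(i < p) d i 0 *: delta_mx i 0.
Proof.
rewrite [LHS]matrix_sum_delta; apply: eq_bigr => i _.
by rewrite big_ord_recl big_ord0 addr0.
Qed.

Lemma is_derive_dot f x d : differentiable f x ->
  is_derive x d f (\sum_(i < p) 'D_(delta_mx i 0) f x * d i 0).
Proof.
move=> fx; split; first exact: diff_derivable.
rewrite deriveE // {1}(cV_sum_delta d) linear_sum; apply: eq_bigr => i _.
by rewrite linearZ /= deriveE // mulrC.
Qed.

Lemma is_derive_line_grad f x d t : (forall x, differentiable f x) ->
  is_derive t (1 : R) (fun u => f (x + u *: d)) (dot (grad f (x + t *: d)) d).
Proof.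
move=> fd; apply: (is_derive_line f x d t _).1.
have -> : dot (grad f (x + t *: d)) d = 
  \sum_(i < p) 'D_(delta_mx i 0) f (x + t *: d) * d i 0.
  by apply: eq_bigr => i _; rewrite mxE.
exact: is_derive_dot.
Qed.

Lemma is_derive_line_hessian f x d v t : twice_differentiable f ->
  (forall x, (hessian f x)^T = hessian f x) ->
  is_derive t (1 : R) (fun u => dot v (grad f (x + u *: d)))
                (dot v (hessian f (x + t *: d) *m d)).
Proof.
move=> [_ gd] hT.
have gi_d (i : 'I_p) y : differentiable ('D_(delta_mx i 0) f) y.
  have -> : 'D_(delta_mx i 0) f = (fun A : 'cV[R]_p => A i 0) \o grad f.
    by apply/funext => z /=; rewrite mxE.
  by apply: differentiable_comp => //; exact: differentiable_coord.
have -> : (fun u => dot v (grad f (x + u *: d))) =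
  \sum_(i < p) (fun u => v i 0 *: 'D_(delta_mx i 0) f (x + u *: d)).
  by apply/funext => u; rewrite fct_sumE; apply: eq_bigr => i _; rewrite mxE.
apply: is_derive_sum => i; apply: is_deriveZ.
apply: (is_derive_line ('D_(delta_mx i 0) f) x d t _).1.
(* Differentiating the [i]-th partial produces the entries [(j, i)] of [hessian], so the symmetry
   assumption is what turns them into row [i]. *)
have -> : (hessian f (x + t *: d) *m d) i 0 =
   \sum_(j < p) 'D_(delta_mx j 0) ('D_(delta_mx i 0) f) (x + t *: d) * d j 0.
  by rewrite -hT mxE; apply: eq_bigr => j _; rewrite !mxE.
exact: is_derive_dot.
Qed.

(** The Frobenius norm is a bound, by Cauchy-Schwarz on each row. It ensures that the [sup] in
    [specnorm] is a true supremum and not a default value. *)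
Lemma specnorm_has_ubound (A : 'M[R]_p) :
  has_ubound [set enorm (A *m v) | v in [set v : 'cV[R]_p | enorm v <= 1]].
Proof.
pose r i : 'cV[R]_p := (row i A)^T.
exists (Num.sqrt (\sum_i dot (r i) (r i))) => _ [v /= v1 <-].
have s0 : 0 <= \sum_i dot (r i) (r i).
  by rewrite sumr_ge0 // => i _; exact: dot_ge0.
apply: enorm_le; first exact: sqrtr_ge0.
rewrite sqr_sqrtr // {1}/dot; apply: ler_sum => i _.
have -> : (A *m v) i 0 = dot (r i) v.
  by rewrite mxE; apply: eq_bigr => j _; rewrite !mxE.
rewrite -expr2; apply: le_trans (dot_CS _ _) _.
rewrite -[leRHS]mulr1 ler_wpM2l ?dot_ge0 // -sqr_enorm.
by rewrite expr_le1 ?enorm_ge0.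
Qed.

Lemma specnorm_ge0 (A : 'M[R]_p) : 0 <= specnorm A.
Proof.
have /ubP := ub_le_sup (specnorm_has_ubound A); apply.
exists 0; first by rewrite /= enormE dot0r sqrtr0.
by rewrite mulmx0 enormE dot0r sqrtr0.
Qed.

Lemma enorm_eq0P (v : 'cV[R]_p) : enorm v = 0 -> v = 0.
Proof.
move=> v0; have := sqr_enorm v; rewrite v0 expr0n => /esym/eqP.
rewrite psumr_eq0 => [/allP h|i _]; last by rewrite -expr2 sqr_ge0.
apply/colP => i; rewrite mxE; apply/eqP.
by have := h i; rewrite mem_index_enum => /(_ isT); rewrite -expr2 sqrf_eq0.
Qed.

Lemma enorm_mulmx_le (A : 'M[R]_p) v : enorm (A *m v) <= specnorm A * enorm v.
Proof.
have [v0|v0] := eqVneq (enorm v) 0.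
  by rewrite v0 mulr0 (enorm_eq0P v0) mulmx0 enormE dot0r sqrtr0.
have v_gt0 : 0 < enorm v by rewrite lt_neqAle eq_sym v0 enorm_ge0.
rewrite -ler_pdivrMr // mulrC.
have -> : (enorm v)^-1 * enorm (A *m v) = enorm (A *m ((enorm v)^-1 *: v)).
  by rewrite -scalemxAr enormZ ger0_norm // invr_ge0 enorm_ge0.
have /ubP := ub_le_sup (specnorm_has_ubound A); apply; eexists; last by [].
by rewrite /= enormZ ger0_norm ?invr_ge0 ?enorm_ge0 // mulVf.
Qed.

End Calculus.

(** * Block structure of stacked vectors and Kronecker products *)

Section Blocks.
Context {R : realType} {n p : nat}.
Implicit Types (v w : 'cV[R]_(n * p)) (i j : 'I_n) (a : 'I_p).

Lemma big_mxtens (F : 'I_(n * p) -> R) :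
  \sum_k F k = \sum_i \sum_a F (mxtens_index (i, a)).
Proof.
rewrite pair_big /= (reindex (@mxtens_index n p)) /=; last first.
  exists (@mxtens_unindex n p) => k _;
  by rewrite (mxtens_indexK, mxtens_unindexK).
by apply: eq_bigr => -[].
Qed.

Lemma dot_block v w : dot v w = \sum_i dot (block v i) (block w i).
Proof.
rewrite [LHS]big_mxtens; apply: eq_bigr => i _; apply: eq_bigr => a _.
by rewrite !mxE.
Qed.

Lemma blockD v w i : block (v + w) i = block v i + block w i.
Proof. by apply/colP => a; rewrite !mxE. Qed.

Lemma blockB v w i : block (v - w) i = block v i - block w i.
Proof. by apply/colP => a; rewrite !mxE. Qed.

Lemma blockZ (t : R) v i : block (t *: v) i = t *: block v i.
Proof. by apply/colP => a; rewrite !mxE. Qed.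

Lemma block_blockdiag (A : 'I_n -> 'M[R]_p) v i :
  block (blockdiag A *m v) i = A i *m block v i.
Proof.
apply/colP => a; rewrite !mxE big_mxtens (bigD1 i) //= [X in _ + X]big1 ?addr0.
  by apply: eq_bigr => b _; rewrite !mxE !mxtens_indexK eqxx.
move=> j ji; apply: big1 => b _.
by rewrite !mxE !mxtens_indexK eq_sym (negPf ji) mul0r.
Qed.

Lemma dot_blockdiag (A : 'I_n -> 'M[R]_p) v w :
  dot v (blockdiag A *m w) = \sum_i dot (block v i) (A i *m block w i).
Proof.
by rewrite dot_block; apply: eq_bigr => i _; rewrite block_blockdiag.
Qed.

Lemma blockdiag_sym (A : 'I_n -> 'M[R]_p) :
  (forall i, (A i)^T = A i) -> (blockdiag A)^T = blockdiag A.
Proof.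
move=> AT; apply/matrixP => k l; rewrite !mxE.
case: (mxtens_unindex k) (mxtens_unindex l) => [i a] [j b].
by rewrite eq_sym; case: eqP => // ->; rewrite -[in LHS]AT mxE.
Qed.

Lemma enorm_block_le v i : enorm (block v i) <= enorm v.
Proof.
apply: enorm_le; rewrite ?enorm_ge0 // sqr_enorm dot_block (bigD1 i) //=.
by rewrite lerDl sumr_ge0 // => j _; exact: dot_ge0.
Qed.

(** Cauchy-Schwarz for the vectors of block norms, whose Euclidean norms are those of [v] and
    [w]. *)
Lemma sum_enorm_block_le v w :
  \sum_i enorm (block v i) * enorm (block w i) <= enorm v * enorm w.
Proof.
pose e (u : 'cV[R]_(n * p)) : 'cV[R]_n := \col_i enorm (block u i).
have eE u : enorm (e u) = enorm u.
  rewrite !enormE [in RHS]dot_block; congr Num.sqrt; apply: eq_bigr => i _.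
  by rewrite mxE -expr2 sqr_enorm.
rewrite -(eE v) -(eE w); apply: le_trans (dot_le_enorm _ _).
by apply: ler_sum => i _; rewrite !mxE.
Qed.

Lemma dot_Zmx (W : 'M[R]_n) v w : dot v (Zmx p W *m w) =
  \sum_a \sum_i \sum_j
    W i j * v (mxtens_index (i, a)) 0 * w (mxtens_index (j, a)) 0.
Proof.
rewrite [LHS]big_mxtens exchange_big; apply: eq_bigr => a _.
apply: eq_bigr => i _; rewrite mxE big_mxtens mulr_sumr; apply: eq_bigr => j _.
rewrite (bigD1 a) //= big1 ?addr0 => [|b ba].
  by rewrite !mxE !mxtens_indexK eqxx mulr1 mulrA [v _ _ * _]mulrC.
by rewrite !mxE !mxtens_indexK /= eq_sym (negPf ba) mulr0 mul0r.
Qed.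

Lemma dot_Zdmx (W : 'M[R]_n) v w : dot v (Zdmx p W *m w) =
  \sum_i W i i * dot (block v i) (block w i).
Proof.
rewrite [LHS]big_mxtens; apply: eq_bigr => i _; rewrite mulr_sumr.
apply: eq_bigr => a _.
by rewrite mul_diag_mx !mxE !mxtens_indexK eqxx mulr1 mulrCA.
Qed.

Lemma Zmx_sym (W : 'M[R]_n) : W^T = W -> (Zmx p W)^T = Zmx p W.
Proof. by move=> WT; rewrite /Zmx trmx_tens WT trmx1. Qed.

End Blocks.

(** * Quadratic forms of the weight matrix: the Laplacian and B *)

Section Weights.
Context {R : realType} {n p : nat} {W : 'M[R]_n}.
Hypotheses (WT : W^T = W) (W_ge0 : forall i j, 0 <= W i j)
  (W_sum : forall i, \sum_j W i j = 1).
Implicit Type v : 'cV[R]_(n * p).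

(** Stated for both signs at once: [e = -1] gives the Laplacian form of I - W, and [e = 1] the
    signless form of I + W. By symmetry the column sums are 1 as well, so both pure squares give the
    same sum. *)
Lemma weights_sum_sqr (e : R) (x : 'I_n -> R) : e ^+ 2 = 1 ->
  \sum_i \sum_j W i j * (x i + e * x j) ^+ 2 =
  2 * \sum_i x i ^+ 2 + 2 * e * \sum_i \sum_j W i j * x i * x j.
Proof.
move=> e2.
have -> : \sum_i \sum_j W i j * (x i + e * x j) ^+ 2 =
  \sum_i \sum_j W i j * x i ^+ 2 + \sum_i \sum_j W i j * x j ^+ 2
  + 2 * e * \sum_i \sum_j W i j * x i * x j.
  rewrite !mulr_sumr -!big_split; apply: eq_bigr => i _ /=.
  rewrite !mulr_sumr -!big_split; apply: eq_bigr => j _ /=.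
  by rewrite sqrrD exprMn e2; ring.
congr (_ + _); rewrite [X in _ + X]exchange_big /= mulr2n mulrDl mul1r.
congr (_ + _).
  by apply: eq_bigr => i _; rewrite -mulr_suml W_sum mul1r.
apply: eq_bigr => i _; rewrite -mulr_suml.
rewrite -[in RHS](mul1r (x i ^+ 2)) -(W_sum i); congr (_ * _).
by apply: eq_bigr => j _; rewrite -[in LHS]WT mxE.
Qed.

Lemma weights_laplacian_ge0 (x : 'I_n -> R) :
  \sum_i \sum_j W i j * x i * x j <= \sum_i x i ^+ 2.
Proof.
have : 0 <= \sum_i \sum_j W i j * (x i + -1 * x j) ^+ 2.
  by apply: sumr_ge0 => i _; apply: sumr_ge0 => j _; rewrite mulr_ge0 ?sqr_ge0.
by rewrite weights_sum_sqr ?sqrrN ?expr1n //; lra.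
Qed.

(** In the sum of squares for [e = 1], only the diagonal terms are kept. They equal
    [4 * W i i * x i ^+ 2], which accounts for the correction by twice the diagonal in [Bmx]. *)
Lemma weights_signless_ge0 (x : 'I_n -> R) :
  2 * (\sum_i W i i * x i ^+ 2) <=
  \sum_i x i ^+ 2 + \sum_i \sum_j W i j * x i * x j.
Proof.
have : \sum_i W i i * (x i + 1 * x i) ^+ 2 <=
       \sum_i \sum_j W i j * (x i + 1 * x j) ^+ 2.
  apply: ler_sum => i _; rewrite (bigD1 i) //= lerDl.
  by apply: sumr_ge0 => j _; rewrite mulr_ge0 ?sqr_ge0.
rewrite weights_sum_sqr ?expr1n //.
have -> : \sum_i W i i * (x i + 1 * x i) ^+ 2 = 4 * \sum_i W i i * x i ^+ 2.
  by rewrite mulr_sumr; apply: eq_bigr => i _; rewrite mul1r; lra.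
by lra.
Qed.

Lemma dot_mxtens v w : dot v w =
  \sum_a \sum_i v (mxtens_index (i, a)) 0 * w (mxtens_index (i, a)) 0.
Proof. by rewrite [LHS]big_mxtens exchange_big. Qed.

Lemma laplacian_psd v : 0 <= dot v ((1%:M - Zmx p W) *m v).
Proof.
rewrite mulmxBl mul1mx dotBr subr_ge0 dot_Zmx dot_mxtens.
by apply: ler_sum => a _; exact: weights_laplacian_ge0.
Qed.

Lemma dot_Bmx v : dot v (Bmx p W *m v) =
  dot v v - 2 * dot v (Zdmx p W *m v) + dot v (Zmx p W *m v).
Proof. by rewrite mulmxDl mulmxBl mul1mx -scalemxAl dotDr dotBr dotZr. Qed.

Lemma Bmx_psd v : 0 <= dot v (Bmx p W *m v).
Proof.
rewrite dot_Bmx dot_Zdmx dot_Zmx dot_mxtens.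
have -> : \sum_i W i i * dot (block v i) (block v i) =
  \sum_a \sum_i W i i * v (mxtens_index (i, a)) 0 ^+ 2.
  rewrite exchange_big; apply: eq_bigr => i _; rewrite mulr_sumr.
  by apply: eq_bigr => a _; rewrite !mxE.
rewrite mulr_sumr -sumrB -big_split sumr_ge0 // => a _ /=.
by have := weights_signless_ge0 (fun i => v (mxtens_index (i, a)) 0); lra.
Qed.

Lemma Bmx_le v : dot v (Bmx p W *m v) <= 2 * dot v ((1%:M - Zdmx p W) *m v).
Proof.
rewrite dot_Bmx; have := laplacian_psd v; rewrite !mulmxBl !mul1mx !dotBr.
by lra.
Qed.

Lemma Bmx_sym : (Bmx p W)^T = Bmx p W.
Proof.
rewrite /Bmx !linearD linearN !linearZ /= trmx1 Zmx_sym //.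
by rewrite /Zdmx tr_diag_mx.
Qed.

End Weights.

(** * Comparison of block diagonal quadratic forms *)

Lemma loewner_dot (R : realType) k (A B : 'M[R]_k) v : loewner A B ->
  dot v (A *m v) <= dot v (B *m v).
Proof.
by move=> [_ /(_ v)]; rewrite dot_mulmxE mulmxBl dotBr subr_ge0.
Qed.

Section BlockdiagForms.
Context {R : realType} {n p : nat}.
Implicit Types (A : 'I_n -> 'M[R]_p) (G C : 'M[R]_(n * p)).
Implicit Types v w : 'cV[R]_(n * p).

Lemma blockdiag_variation A A' (l : R) v :
    (forall i x, dot x (A' i *m x) <= dot x (A i *m x) + l * dot x x) ->
  dot v (blockdiag A' *m v) <= dot v (blockdiag A *m v) + l * dot v v.
Proof.
move=> h; rewrite !dot_blockdiag [X in _ * X]dot_block mulr_sumr -big_split.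
by apply: ler_sum => i _; exact: h.
Qed.

Lemma blockdiag_Lipschitz A A' (l : R) v w : 0 <= l ->
    (forall i, specnorm (A' i - A i) <= l) ->
  dot v (blockdiag A' *m w) <=
  dot v (blockdiag A *m w) + l * (enorm v * enorm w).
Proof.
move=> l0 h; rewrite !dot_blockdiag -lerBlDl -sumrB.
apply: le_trans (ler_wpM2l l0 (sum_enorm_block_le v w)).
rewrite mulr_sumr; apply: ler_sum => i _; rewrite -dotBr -mulmxBl.
apply: le_trans (dot_le_enorm _ _) _; rewrite mulrCA ler_wpM2l ?enorm_ge0 //.
apply: le_trans (enorm_mulmx_le _ _) _.
by rewrite ler_wpM2r ?enorm_ge0.
Qed.

Lemma affine_form_le G G' C (alpha e x : R) v w : 0 <= alpha ->
    dot v (G' *m w) <= dot v (G *m w) + e * x ->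
  dot v ((alpha *: G' + C) *m w) <=
  dot v ((alpha *: G + C) *m w) + alpha * e * x.
Proof.
move=> a0 h; rewrite !mulmxDl !dotDr -!scalemxAl !dotZr addrAC lerD2r.
by rewrite -mulrA -mulrDr ler_wpM2l.
Qed.

End BlockdiagForms.

(** * Gradient, Hessian and spectral bounds of the penalized objective *)

Section PenalizedObjective.
Context {R : realType} {n p : nat}.
Variables (W : 'M[R]_n) (alpha delta Delta m M L : R).
Variable f : 'I_n -> 'cV[R]_p -> R.
Hypotheses (WT : W^T = W) (W_ge0 : forall i j, 0 <= W i j)
  (W_sum : forall i, \sum_j W i j = 1)
  (W_diag : forall i, delta <= W i i <= Delta)
  (alpha_gt0 : 0 < alpha) (m_gt0 : 0 < m) (Delta_lt1 : Delta < 1)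
  (f_C2 : forall i, twice_differentiable (f i))
  (hessian_bounds : forall i x,
     loewner m%:M (hessian (f i) x) /\ loewner (hessian (f i) x) M%:M).
Implicit Types (y d v w : 'cV[R]_(n * p)).

Local Notation F := (Fobj W alpha f).
Local Notation Dm := (Dmx W alpha f).
Local Notation Bm := (Bmx p W).
Let c : R := 2 * (1 - Delta) + alpha * m.
Let U : R := 2 * (1 - delta) + alpha * M.
Let rho : R := 2 * (1 - delta) / (2 * (1 - delta) + alpha * m).

Lemma hessian_ge i x (v : 'cV_p) : m * dot v v <= dot v (hessian (f i) x *m v).
Proof.
have [/(loewner_dot v) + _] := hessian_bounds i x.
by rewrite mul_scalar_mx dotZr.
Qed.

Lemma hessian_le i x (v : 'cV_p) : dot v (hessian (f i) x *m v) <= M * dot v v.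
Proof.
have [_ /(loewner_dot v)] := hessian_bounds i x.
by rewrite mul_scalar_mx dotZr.
Qed.

(** Symmetry is part of the Loewner bound, because [psdmx] includes it. *)
Lemma hessian_sym i x : (hessian (f i) x)^T = hessian (f i) x.
Proof.
have [[+ _] _] := hessian_bounds i x; rewrite linearB /= tr_scalar_mx.
by move/(congr1 (+%R^~ m%:M)); rewrite !subrK.
Qed.

Lemma dot_Dmx y v w : dot v (Dm y *m w) =
  \sum_i (alpha * dot (block v i) (hessian (f i) (block y i) *m block w i)
          + 2 * (1 - W i i) * dot (block v i) (block w i)).
Proof.
rewrite mulmxDl -!scalemxAl mulmxBl mul1mx dotDr !dotZr dotBr dot_Zdmx.
rewrite dot_blockdiag [X in 2 * (X - _)]dot_block -sumrB !mulr_sumr -big_split.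
by apply: eq_bigr => i _ /=; ring.
Qed.

Lemma Dmx_ge y v : c * dot v v <= dot v (Dm y *m v).
Proof.
rewrite dot_Dmx [X in _ * X]dot_block mulr_sumr; apply: ler_sum => i _.
have := hessian_ge i (block y i) (block v i).
have := dot_ge0 (block v i); have /andP[_] := W_diag i.
move=> h1 h2 /(ler_wpM2l (ltW alpha_gt0)).
by have := ler_wpM2r h2 h1; rewrite /c; lra.
Qed.

Lemma Dmx_le y v : dot v (Dm y *m v) <= U * dot v v.
Proof.
rewrite dot_Dmx [X in _ * X]dot_block mulr_sumr; apply: ler_sum => i _.
have := hessian_le i (block y i) (block v i).
have := dot_ge0 (block v i); have /andP[+ _] := W_diag i.
move=> h1 h2 /(ler_wpM2l (ltW alpha_gt0)).
by have := ler_wpM2r h2 h1; rewrite /U; lra.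
Qed.

Lemma Dmx_sym y : (Dm y)^T = Dm y.
Proof.
rewrite /Dmx linearD !linearZ linearB /= trmx1 tr_diag_mx.
by rewrite /Gmx blockdiag_sym // => i; exact: hessian_sym.
Qed.

Lemma Bmx_le_Dmx y v : dot v (Bm *m v) <= rho * dot v (Dm y *m v).
Proof.
apply: le_trans (Bmx_le WT W_ge0 W_sum v) _.
rewrite mulmxBl mul1mx dotBr dot_Zdmx [X in 2 * (X - _)]dot_block -sumrB.
rewrite dot_Dmx !mulr_sumr; apply: ler_sum => i _.
have := hessian_ge i (block y i) (block v i).
have := dot_ge0 (block v i); have /andP[wd wD] := W_diag i.
have am : 0 < alpha * m by rewrite mulr_gt0.
have d1 : delta < 1 := le_lt_trans (le_trans wd wD) Delta_lt1.
move: (dot (block v i) (block v i)) (dot _ (hessian _ _ *m _)) => x z x0 zx.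
rewrite /rho [leRHS]mulrAC ler_pdivlMr; last first.
  by rewrite addr_gt0 // mulr_gt0 // subr_gt0.
(* After clearing the denominator, the claim is the sum of two defects: that of [delta <= W i i]
   weighted by [alpha * m], and that of [m * x <= z] weighted by [alpha * (1 - delta)]. *)
have h1 : 0 <= (W i i - delta) * x by rewrite mulr_ge0 // subr_ge0.
have h2 : 0 <= (1 - delta) * (z - m * x) by rewrite mulr_ge0 ?subr_ge0 //; lra.
have h3 := mulr_ge0 (ltW am) h1; have h4 := mulr_ge0 (ltW alpha_gt0) h2.
by lra.
Qed.

Lemma hessianF_E y : Dm y - Bm = 1%:M - Zmx p W + alpha *: Gmx f y.
Proof.
rewrite /Dmx /Bmx scalerBr scaler_nat mulr2n; move: (alpha *: _) => G.
by apply/matrixP => k l; rewrite !mxE; ring.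
Qed.

Lemma hessianF_ge y v : alpha * m * dot v v <= dot v ((Dm y - Bm) *m v).
Proof.
rewrite hessianF_E mulmxDl dotDr -[leLHS]add0r; apply: lerD.
  exact: laplacian_psd.
rewrite -scalemxAl dotZr -mulrA ler_wpM2l ?(ltW alpha_gt0) // dot_blockdiag.
by rewrite dot_block mulr_sumr; apply: ler_sum => i _; exact: hessian_ge.
Qed.

Lemma Dmx_variation y y' v :
  dot v (Dm y' *m v) <= dot v (Dm y *m v) + alpha * (M - m) * dot v v.
Proof.
apply: affine_form_le (ltW alpha_gt0) _; apply: blockdiag_variation => i x.
apply: le_trans (hessian_le i (block y' i) x) _.
rewrite -lerBlDr -mulrBl opprB addrC subrK; exact: hessian_ge.
Qed.

Hypotheses (L_ge0 : 0 <= L) (hessian_Lipschitz : forall i x x',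
  specnorm (hessian (f i) x - hessian (f i) x') <= L * enorm (x - x')).

Lemma Dmx_Lipschitz y y' v w : dot v (Dm y' *m w) <=
  dot v (Dm y *m w) + alpha * (L * enorm (y' - y)) * (enorm v * enorm w).
Proof.
apply: affine_form_le (ltW alpha_gt0) _; apply: blockdiag_Lipschitz => [|i].
  by rewrite mulr_ge0 ?enorm_ge0.
apply: le_trans (hessian_Lipschitz _ _ _) _; rewrite ler_wpM2l //.
by rewrite -blockB enorm_block_le.
Qed.

(** Closed form of the gradient. Its line derivatives are computed first, and coordinate directions
    then identify it with [grad F] in [grad_Fobj]. *)
Let gF y : 'cV[R]_(n * p) := (1%:M - Zmx p W) *m y +
  alpha *: \col_k grad (f (mxtens_unindex k).1) (block y (mxtens_unindex k).1)
              (mxtens_unindex k).2 0.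

Let dot_gF v y : dot v (gF y) = dot v ((1%:M - Zmx p W) *m y) +
  alpha * \sum_i dot (block v i) (grad (f i) (block y i)).
Proof.
rewrite dotDr dotZr [in X in _ + X]dot_block; congr (_ + _ * _).
apply: eq_bigr => i _; congr dot; apply/colP => a.
by rewrite !mxE mxtens_indexK.
Qed.

Let ImZ_sym : (1%:M - Zmx p W)^T = 1%:M - Zmx p W.
Proof. by rewrite linearB /= trmx1 Zmx_sym. Qed.

Let Fobj_line_gF y d (t : R) :
  is_derive t (1 : R) (fun u => F (y + u *: d)) (dot (gF (y + t *: d)) d).
Proof.
set A := 1%:M - Zmx p W.
(* On a line the network term is a polynomial in the parameter, so it can be differentiated
   formally. *)
pose q := (2^-1 * dot y (A *m y))%:P + (dot d (A *m y)) *: 'X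
          + (2^-1 * dot d (A *m d)) *: ('X * 'X) : {poly R}.
have -> : (fun u => F (y + u *: d)) =
  horner q + alpha \*: \sum_(i < n) (fun u => f i (block y i + u *: block d i)).
  apply/funext => u; rewrite /= fctE /= fct_sumE /Fobj.
  congr (_ + _ * _); last by apply: eq_bigr => i _; rewrite blockD blockZ.
  rewrite dot_mulmxE mulmxDr -scalemxAr !(dotDl, dotDr, dotZl, dotZr) /q.
  rewrite -/A !(hornerD, hornerC, hornerZ, hornerM, hornerX).
  have -> : dot y (A *m d) = dot d (A *m y) by rewrite dot_sym // dotC.
  by field.
have -> : dot (gF (y + t *: d)) d = q^`().[t] +
   alpha *: \sum_(i < n)
     dot (grad (f i) (block y i + t *: block d i)) (block d i).
  rewrite dotC dot_gF; congr (_ + _ * _).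
    rewrite mulmxDr -scalemxAr dotDr dotZr /q !poly.derivE !hornerE -/A.
    by field.
  by apply: eq_bigr => i _; rewrite blockD blockZ dotC.
apply: is_deriveD; apply: is_deriveZ; apply: is_derive_sum => i.
apply: is_derive_line_grad => x; exact: (f_C2 i).1.
Qed.

Lemma grad_Fobj y : grad F y = gF y.
Proof.
apply/colP => k; rewrite mxE.
have := Fobj_line_gF y (delta_mx k 0) 0.
move=> /(is_derive_line F y (delta_mx k 0) 0 _).2; rewrite scale0r addr0.
move=> /@derive_val ->; move: (gF y) => g; rewrite /dot (bigD1 k) //= big1.
  by rewrite mxE !eqxx mulr1 addr0.
by move=> i ik; rewrite mxE (negPf ik) mulr0.
Qed.

Lemma is_derive_Fobj_line y d (t : R) :
  is_derive t (1 : R) (fun u => F (y + u *: d)) (dot (grad F (y + t *: d)) d).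
Proof. by rewrite grad_Fobj; exact: Fobj_line_gF. Qed.

Lemma is_derive_grad_line y d v (t : R) :
  is_derive t (1 : R) (fun u => dot v (grad F (y + u *: d)))
    (dot v ((Dm (y + t *: d) - Bm) *m d)).
Proof.
set A := 1%:M - Zmx p W.
pose q := (dot v (A *m y))%:P + (dot v (A *m d)) *: 'X : {poly R}.
have -> : (fun u => dot v (grad F (y + u *: d))) = horner q + alpha \*:
   \sum_(i < n) (fun u => dot (block v i)
                           (grad (f i) (block y i + u *: block d i))).
  apply/funext => u; rewrite /= fctE /= fct_sumE grad_Fobj dot_gF.
  congr (_ + _ * _); last by apply: eq_bigr => i _; rewrite blockD blockZ.
  by rewrite -/A mulmxDr -scalemxAr dotDr dotZr /q !hornerE mulrC.
have -> : dot v ((Dm (y + t *: d) - Bm) *m d) = q^`().[t] + alpha *: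
   \sum_(i < n) dot (block v i)
      (hessian (f i) (block y i + t *: block d i) *m block d i).
  rewrite hessianF_E mulmxDl dotDr -scalemxAl dotZr; congr (_ + _ * _).
    by rewrite /q !poly.derivE !hornerE.
  by rewrite dot_blockdiag; apply: eq_bigr => i _; rewrite blockD blockZ.
apply: is_deriveD; apply: is_deriveZ; apply: is_derive_sum => i.
by apply: is_derive_line_hessian => // x; exact: hessian_sym.
Qed.

End PenalizedObjective.

(** * Taylor and gradient estimates from derivatives along lines *)

Section SmoothFunction.
Context {R : realType} {k : nat}.
Variables (F : 'cV[R]_k -> R) (g : 'cV[R]_k -> 'cV[R]_k).
Variable H : 'cV[R]_k -> 'M[R]_k.
Hypotheses
  (F_line : forall y d (t : R),
     is_derive t (1 : R) (fun u => F (y + u *: d)) (dot (g (y + t *: d)) d))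
  (g_line : forall y d v (t : R),
     is_derive t (1 : R) (fun u => dot v (g (y + u *: d)))
       (dot v (H (y + t *: d) *m d))).
Implicit Types y d v w : 'cV[R]_k.

Lemma taylor_le y d (a b : R) :
    (forall t, 0 <= t <= 1 -> dot d (H (y + t *: d) *m d) <= a + b * t) ->
  F (y + d) <= F y + dot (g y) d + a / 2 + b / 6.
Proof.
move=> h; have := @taylor2_le _ (fun u => F (y + u *: d))
  (fun u => dot (g (y + u *: d)) d) _ a b (F_line y d) _ h.
rewrite scale1r scale0r addr0; apply => t.
under eq_fun do rewrite dotC; exact: g_line.
Qed.

Section Curvature.
Variables l U : R.
Hypotheses (H_ge : forall y v, l * dot v v <= dot v (H y *m v))
  (H_le : forall y v, dot v (H y *m v) <= U * dot v v).

Lemma smooth_upper y d : F (y + d) <= F y + dot (g y) d + U / 2 * dot d d.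
Proof.
have : F (y + d) <= F y + dot (g y) d + (U * dot d d) / 2 + 0 / 6.
  by apply: taylor_le => t _; rewrite mul0r addr0.
by lra.
Qed.

Lemma strongly_convex_lower y d :
  F y + dot (g y) d + l / 2 * dot d d <= F (y + d).
Proof.
have : - F (y + 1 *: d) <= - F (y + 0 *: d) + - dot (g (y + 0 *: d)) d
       + - (l * dot d d) / 2 + 0 / 6.
  apply: (@taylor2_le _ (fun u => - F (y + u *: d))
    (fun u => - dot (g (y + u *: d)) d)
    (fun u => - dot d (H (y + u *: d) *m d))) => t.
  - under eq_fun do rewrite dotC; exact: is_deriveN (g_line y d d t).
  - by move=> _; rewrite mul0r addr0 lerN2.
by rewrite scale1r scale0r addr0; lra.
Qed.

Variable ystar : 'cV[R]_k.
Hypothesis ystar_argmin : forall z, F ystar <= F z.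

(** A gradient step of length [U^-1] minimizes the quadratic upper bound, and its value cannot drop
    below [F ystar]. *)
Lemma sqr_enorm_grad_le y : 0 < U ->
  enorm (g y) ^+ 2 <= 2 * U * (F y - F ystar).
Proof.
move=> U0; have := smooth_upper y (- U^-1 *: g y).
rewrite !(dotZl, dotZr) sqr_enorm; set x := dot _ _ => h.
have := le_trans (ystar_argmin _) h.
have -> : F y + - U^-1 * x + U / 2 * (- U^-1 * (- U^-1 * x)) =
          F y - x / (2 * U).
  by field; rewrite gt_eqF.
by rewrite lerBrDl -lerBrDr ler_pdivrMr ?mulr_gt0 // mulrC.
Qed.

(** The Polyak-Lojasiewicz inequality. The nonnegative square of [g y + l *: (ystar - y)] bounds the
    quadratic lower bound at [ystar] from below. *)
Lemma sqr_enorm_grad_ge y : 0 < l ->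
  2 * l * (F y - F ystar) <= enorm (g y) ^+ 2.
Proof.
move=> l0; have := strongly_convex_lower y (ystar - y).
rewrite [y + _]addrC subrK.
have := dot_ge0 (g y + l *: (ystar - y)).
rewrite sqr_enorm !(dotDl, dotDr, dotZl, dotZr, dotNl, dotNr).
rewrite [dot ystar (g y)]dotC [dot y (g y)]dotC.
move: (dot (g y) ystar) (dot (g y) y) (dot ystar _) (dot y _) (dot _ _).
by move=> a b e e' x h1 /(ler_wpM2l (ltW l0)); lra.
Qed.

End Curvature.

Lemma taylor_variation (e : R) y d :
    (forall y y' v, dot v (H y' *m v) <= dot v (H y *m v) + e * dot v v) ->
  F (y + d) <= F y + dot (g y) d + dot d (H y *m d) / 2 + e * enorm d ^+ 2 / 2.
Proof.
move=> H_var.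
have : F (y + d) <=
    F y + dot (g y) d + (dot d (H y *m d) + e * dot d d) / 2 + 0 / 6.
  by apply: taylor_le => t _; rewrite mul0r addr0.
by rewrite sqr_enorm; lra.
Qed.

Variable Lh : R.
Hypotheses (Lh_ge0 : 0 <= Lh) (H_Lip : forall y y' v w,
  dot v (H y' *m w) <=
  dot v (H y *m w) + Lh * enorm (y' - y) * (enorm v * enorm w)).

Let enorm_line y d (t : R) : 0 <= t -> enorm (y + t *: d - y) = t * enorm d.
Proof. by move=> t0; rewrite addrAC subrr add0r enormZ ger0_norm. Qed.

Lemma taylor_cubic y d :
  F (y + d) <= F y + dot (g y) d + dot d (H y *m d) / 2 + Lh * enorm d ^+ 3 / 6.
Proof.
apply: taylor_le => t /andP[t0 _].
apply: le_trans (H_Lip y _ _ _) _; rewrite enorm_line // lerD2l.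
by rewrite le_eqVlt; apply/orP; left; apply/eqP; ring.
Qed.

(** The gradient along the line is tested against the remainder [r] itself, which reduces the vector
    estimate to a scalar one; then one factor [enorm r] is divided out. *)
Lemma grad_taylor y d :
  enorm (g (y + d) - g y - H y *m d) <= Lh / 2 * enorm d ^+ 2.
Proof.
set r := _ - _ - _.
have : dot r (g (y + 1 *: d)) <= dot r (g (y + 0 *: d)) +
    dot r (H y *m d) + Lh * enorm d ^+ 2 * enorm r / 2.
  apply: (taylor1_le (g_line y d r)) => t /andP[t0 _].
  apply: le_trans (H_Lip y _ _ _) _; rewrite enorm_line // lerD2l.
  by rewrite le_eqVlt; apply/orP; left; apply/eqP; ring.
rewrite scale1r scale0r addr0 => h.
have rE : enorm r ^+ 2 = dot r (g (y + d)) - dot r (g y) - dot r (H y *m d).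
  by rewrite sqr_enorm -!dotBr.
have : enorm r * enorm r <= Lh / 2 * enorm d ^+ 2 * enorm r by lra.
have : 0 <= Lh / 2 * enorm d ^+ 2 by rewrite mulr_ge0 ?sqr_ge0 // divr_ge0.
have := enorm_ge0 r.
by rewrite le_eqVlt => /orP[/eqP<-//|r0] _; rewrite ler_pM2r.
Qed.

End SmoothFunction.

(** * The contraction factor of the objective gap *)

Section Rates.
Context {R : realFieldType}.
Implicit Types A eps r : R.

(** The factor of the gap in one step, with [A] for alpha m lambda and [r] for the Taylor remainder
    relative to [eps] times the form of the approximate inverse. *)
Definition decrease_factor A eps r : R := 1 - A * eps * (2 - eps - 2 * r).

(* A convex combination of convex combinations: squaring it by convexity twice
   is what yields [decrease_factor_sqr]. *)
Lemma decrease_factor_convex A eps r : decrease_factor A eps r =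
  (1 - A) + A * ((1 - eps) * (1 - eps) + eps * (2 * r)).
Proof. by rewrite /decrease_factor; ring. Qed.

Lemma sqr_convex (x y t : R) : 0 <= t <= 1 ->
  ((1 - t) * x + t * y) ^+ 2 <= (1 - t) * x ^+ 2 + t * y ^+ 2.
Proof.
move=> /andP[t0 t1]; rewrite -subr_ge0.
have -> : (1 - t) * x ^+ 2 + t * y ^+ 2 - ((1 - t) * x + t * y) ^+ 2 =
  t * (1 - t) * (x - y) ^+ 2 by ring.
by rewrite mulr_ge0 ?sqr_ge0 // mulr_ge0 // subr_ge0.
Qed.

Section DecreaseFactor.
Variables (A eps r T1 : R).
Hypotheses (A01 : 0 <= A <= 1) (eps01 : 0 <= eps <= 1) (r_ge0 : 0 <= r)
  (T1_ge0 : 0 <= T1)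
  (sqr_r_le : 16 * (A * r ^+ 2) <= 3 * T1 * eps).

Let A_ge0 : 0 <= A. Proof. by case/andP: A01. Qed.

Lemma decrease_factor_ge0 : 0 <= decrease_factor A eps r.
Proof.
case/andP: A01 eps01 => A0 A1 /andP[e0 e1].
rewrite decrease_factor_convex addr_ge0 ?subr_ge0 // mulr_ge0 // addr_ge0 //.
  by rewrite mulr_ge0 ?subr_ge0.
by rewrite !mulr_ge0.
Qed.

Lemma decrease_factor_sqr :
  decrease_factor A eps r ^+ 2 <= 1 - ((2 - eps) * eps * A - eps * T1).
Proof.
case/andP: (A01) eps01 => A0 A1 /andP[e0 e1].
rewrite decrease_factor_convex -[1 - A]mulr1.
apply: le_trans (sqr_convex _ _ A01) _; rewrite expr1n mulr1.
have := ler_wpM2l A0 (sqr_convex (1 - eps) (2 * r) eps01).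
have h := ler_wpM2l e0 sqr_r_le.
have h2 : 0 <= A * (eps * (1 - eps) ^+ 2).
  by rewrite mulr_ge0 // mulr_ge0 // sqr_ge0.
have h3 : 0 <= (1 - eps) * (eps * T1) by rewrite !mulr_ge0 // subr_ge0.
have h4 : 0 <= eps * T1 by rewrite mulr_ge0.
move: h h2 h3 h4; lra.
Qed.

Lemma decrease_factor_le : 2 * A * r <= T1 ->
  decrease_factor A eps r <= 1 - ((2 - eps) * eps * A - eps * T1).
Proof.
case/andP: eps01 => e0 _ /(ler_wpM2l e0).
by rewrite /decrease_factor; lra.
Qed.

End DecreaseFactor.

End Rates.

(** * Scalar inequalities between the constants of the theorem *)

(* Dictionary: [a] = alpha m, [l] = sqrt lambda, [c] = 2 (1 - Delta) + alpha m,
   [e] = alpha (M - m), [Lh] = alpha L, [E] = sqrt (F (y 0) - F ystar), and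
   [G] = Gamma1 below. The rational 3 / 2 replaces the sqrt 2 of the gradient
   bound |g| <= sqrt (2 gap / lambda). *)
Section StepConstants.
Context {R : realFieldType}.
Variables (a l c Lam e Lh E eps : R).
Hypotheses (a_gt0 : 0 < a) (l_gt0 : 0 < l) (c_gt0 : 0 < c) (e_ge0 : 0 <= e)
  (Lh_ge0 : 0 <= Lh) (E_ge0 : 0 <= E) (eps01 : 0 <= eps <= 1)
  (l2c_le1 : l ^+ 2 * c <= 1) (Lam_ge : 1 <= Lam * c)
  (ae_le : (a + e) * l ^+ 2 <= 1)
  (eps_le : eps ^+ 2 * Lh * Lam ^+ 3 * E <= 3 * a * l ^+ 5).

Let A : R := a * l ^+ 2.
(** Chosen so that [eps * T1] is the cubic term subtracted in zeta. *)
Let T1 : R := Lh * eps ^+ 2 * Lam ^+ 3 * E / (6 * l ^+ 3).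
(* Coefficient of the Taylor remainder relative to [eps * dot g (Hi g)]: the
   first bound comes from the Lipschitz Hessian, the second from its total
   variation. *)
Let r : R := Num.min (3 / 2 * T1 * l ^+ 2 / Lam) (e * eps * Lam / 2).
Let sigma : R := decrease_factor A eps r.
Let zeta : R := (2 - eps) * eps * A - eps * T1.

Let l2_gt0 : 0 < l ^+ 2. Proof. exact: exprn_gt0. Qed.

Let eps_ge0 : 0 <= eps. Proof. by case/andP: eps01. Qed.

Let Lam_gt0 : 0 < Lam.
Proof. by rewrite -(pmulr_lgt0 _ c_gt0) (lt_le_trans ltr01). Qed.

Let T1_ge0 : 0 <= T1.
Proof.
by rewrite divr_ge0 ?mulr_ge0 ?exprn_ge0 ?(ltW Lam_gt0) ?(ltW l_gt0).
Qed.

Let T1_le : 2 * T1 <= A.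
Proof.
have -> : 2 * T1 = (eps ^+ 2 * Lh * Lam ^+ 3 * E) / (3 * l ^+ 3).
  by rewrite /T1; field; rewrite gt_eqF.
rewrite ler_pdivrMr ?mulr_gt0 ?exprn_gt0 //; apply: le_trans eps_le _.
by rewrite le_eqVlt; apply/orP; left; apply/eqP; rewrite /A; ring.
Qed.

Let el2_ge0 : 0 <= l ^+ 2 * e. Proof. by rewrite mulr_ge0 ?(ltW l2_gt0). Qed.

Let A_ge0 : 0 <= A. Proof. by rewrite mulr_ge0 ?(ltW l2_gt0) ?(ltW a_gt0). Qed.

Let A01 : 0 <= A <= 1.
Proof.
by rewrite A_ge0 /=; have := ae_le; have := el2_ge0; rewrite /A; lra.
Qed.

(** Arithmetic-geometric mean inequality: the two factors are alpha m lambda and alpha (M - m)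
    lambda, whose sum is at most 1. *)
Let Ael2_le : 4 * (A * (l ^+ 2 * e)) <= 1.
Proof.
have : A + l ^+ 2 * e <= 1 by have := ae_le; rewrite /A; lra.
move: (A) (l ^+ 2 * e) A_ge0 el2_ge0 => x y x0 y0 xy1.
have : (x + y) ^+ 2 <= 1 by rewrite expr_le1 // addr_ge0.
by have := sqr_ge0 (x - y); lra.
Qed.

Let r_ge0 : 0 <= r.
Proof.
rewrite le_min; apply/andP; split; rewrite divr_ge0 ?(ltW Lam_gt0) //.
  by rewrite mulr_ge0 ?(ltW l2_gt0) // mulr_ge0.
by rewrite mulr_ge0 ?(ltW Lam_gt0) // mulr_ge0.
Qed.

Let r_le1 : r <= 3 / 2 * T1 * l ^+ 2 / Lam. Proof. by rewrite ge_min lexx. Qed.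

Let r_le2 : r <= e * eps * Lam / 2. Proof. by rewrite ge_min lexx orbT. Qed.

(** The product of the two bounds on [r], in which [Lam] cancels. *)
Let sqr_r_le : 4 * r ^+ 2 <= 3 * T1 * eps * (l ^+ 2 * e).
Proof.
have := ler_pM r_ge0 r_ge0 r_le1 r_le2; rewrite -expr2.
have -> : 3 / 2 * T1 * l ^+ 2 / Lam * (e * eps * Lam / 2) =
  3 / 4 * T1 * eps * (l ^+ 2 * e) by field; rewrite gt_eqF.
by lra.
Qed.

Let A_sqr_r_le : 16 * (A * r ^+ 2) <= 3 * T1 * eps.
Proof.
have h1 := ler_wpM2l A_ge0 sqr_r_le.
have h2 : 0 <= 3 * T1 * eps by rewrite mulr_ge0 // mulr_ge0.
by have := ler_wpM2l h2 Ael2_le; lra.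
Qed.

Let r_le_half : 2 * r <= 1.
Proof.
have e1 : eps <= 1 by case/andP: eps01.
have : 4 * r ^+ 2 <= 1.
  apply: le_trans sqr_r_le _.
  have h1 : 3 * T1 * eps * (l ^+ 2 * e) <= 3 * T1 * (l ^+ 2 * e).
    by rewrite ler_wpM2r // ler_piMr // mulr_ge0.
  by have := ler_wpM2r el2_ge0 T1_le; have := Ael2_le; lra.
have -> : 4 * r ^+ 2 = (2 * r) ^+ 2 by ring.
by rewrite expr_le1 // mulr_ge0.
Qed.

Lemma sigma_ge0 : 0 <= sigma.
Proof. exact: decrease_factor_ge0. Qed.

Lemma sigma_le1 : sigma <= 1.
Proof.
rewrite /sigma /decrease_factor gerBl mulr_ge0 // ?(mulr_ge0 A_ge0) //.
by case/andP: eps01 => _; have := r_le_half; lra.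
Qed.

Lemma sigma_sqr_le : sigma ^+ 2 <= 1 - zeta.
Proof. exact: decrease_factor_sqr. Qed.

Section Descent.
Variables (q q' s N gamma : R).
Hypotheses (N_ge0 : 0 <= N) (q_ge0 : 0 <= q)
  (gamma_le : gamma <= 3 / 2 * (E / l))
  (N_le : N <= Lam * gamma) (N2_le : N ^+ 2 <= Lam * s)
  (s_ge : l ^+ 2 * gamma ^+ 2 <= s) (gamma_ge : 2 * a * q <= gamma ^+ 2)
  (cubic : q' <= q - eps * s + eps ^+ 2 * s / 2 + Lh * (eps * N) ^+ 3 / 6)
  (variation : q' <= q - eps * s + eps ^+ 2 * s / 2 + e * (eps * N) ^+ 2 / 2).

Let s_ge0 : 0 <= s.
Proof. by apply: le_trans s_ge; rewrite mulr_ge0 ?sqr_ge0 ?(ltW l2_gt0). Qed.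

(** Here [q] and [q'] are consecutive gaps, [gamma] is the gradient norm, [N] the norm of the Newton
    direction and [s] its product with the gradient. Each branch of the minimum [r] comes from one
    of the two Taylor bounds. *)
Lemma sufficient_decrease : q' <= q - eps * s + eps ^+ 2 * s / 2 + eps * r * s.
Proof.
rewrite /r; case: (leP (3 / 2 * T1 * l ^+ 2 / Lam)) => _.
  apply: le_trans cubic _; rewrite lerD2l.
  (* One factor [N] is bounded through the initial gap, the other two by [Lam * s], which keeps the
     estimate proportional to [s]. *)
  have N3 : N ^+ 3 <= Lam * (3 / 2 * (E / l) * Lam) * s.
    have N1 : N <= Lam * (3 / 2 * (E / l)).
      by apply: le_trans N_le _; rewrite ler_pM2l.
    by have := ler_pM N_ge0 (sqr_ge0 N) N1 N2_le; rewrite -exprS; lra.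
  have k0 : 0 <= Lh * eps ^+ 3 / 6 by rewrite divr_ge0 // mulr_ge0 // exprn_ge0.
  have -> : eps * (3 / 2 * T1 * l ^+ 2 / Lam) * s =
     Lh * eps ^+ 3 / 6 * (Lam * (3 / 2 * (E / l) * Lam) * s).
    by rewrite /T1; field; rewrite !gt_eqF.
  by apply: le_trans (ler_wpM2l k0 N3); rewrite exprMn; lra.
apply: le_trans variation _; rewrite lerD2l.
have k0 : 0 <= e * eps ^+ 2 / 2 by rewrite divr_ge0 // mulr_ge0 // exprn_ge0.
by have := ler_wpM2l k0 N2_le; lra.
Qed.

Lemma descent_step : q' <= sigma * q.
Proof.
apply: le_trans sufficient_decrease _.
have s2 : 2 * A * q <= s.
  apply: le_trans s_ge; have := ler_wpM2l (ltW l2_gt0) gamma_ge.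
  by rewrite /A; lra.
have k0 : 0 <= eps * (2 - eps - 2 * r).
  rewrite mulr_ge0 //; case/andP: eps01 => _; have := r_le_half; lra.
by have := ler_wpM2l k0 s2; rewrite /sigma /decrease_factor; lra.
Qed.

End Descent.

Section Comparison.
Variable G : R.
Hypotheses (G_ge0 : 0 <= G)
  (G2E : G ^+ 2 = Lh * eps * Lam * E / (l ^+ 3 * c ^+ 2)).

Let kappa := l ^+ 2 * c.

(* A large Gamma1 forces eps to be small, and then the variation bound alone
   beats the cubic term of zeta. *)
Lemma sigma_le : 4 < 3 * kappa * G -> sigma <= 1 - zeta.
Proof.
move=> big; apply: decrease_factor_le => //.
have kG : 16 <= 9 * (kappa * G) ^+ 2.
  have : (4 : R) ^+ 2 <= (3 * kappa * G) ^+ 2.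
    by rewrite ler_sqr ?nnegrE ?(ltW big) // ltW // (lt_trans _ big).
  by rewrite -mulrA [(3 * _) ^+ 2]exprMn; lra.
have T1E : T1 = eps * Lam ^+ 2 * (kappa * G) ^+ 2 / (6 * l ^+ 4).
  rewrite exprMn G2E /T1 /kappa; field.
  by rewrite !gt_eqF // exprn_gt0.
apply: (@le_trans _ _ (A * e * eps * Lam)).
  have : 0 <= 2 * A by rewrite mulr_ge0.
  by move/ler_wpM2l => /(_ _ _ r_le2); lra.
rewrite T1E ler_pdivlMr ?mulr_gt0 ?exprn_gt0 //.
have h1 : A * e * l ^+ 4 * 6 <= 6 / 4 * l ^+ 2.
  by have := ler_wpM2r (ltW l2_gt0) Ael2_le; lra.
have h2 : l ^+ 2 <= Lam.
  rewrite -(ler_pM2r c_gt0); exact: le_trans l2c_le1 Lam_ge.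
have h3 : 6 / 4 * l ^+ 2 <= Lam * (kappa * G) ^+ 2.
  by have := ler_wpM2l (ltW Lam_gt0) kG; have := l2_gt0; lra.
have k0 : 0 <= eps * Lam by rewrite mulr_ge0 ?(ltW Lam_gt0).
by have := ler_wpM2l k0 (le_trans h1 h3); lra.
Qed.

Let kappa_gt0 : 0 < kappa. Proof. exact: mulr_gt0. Qed.

(** Both entries of the minimum are valid constants for comparing consecutive matrices [D]: the
    first through the Lipschitz Hessian, the second through the condition number. [Q] plays the role
    of (1 - zeta)^(t/4). *)
Lemma comparison_factor (q gamma d Q : R) (t : nat) :
    0 <= Q -> Q ^+ 4 = (1 - zeta) ^+ t -> 0 <= q -> 0 <= gamma ->
    q <= sigma ^+ t * E ^+ 2 -> l ^+ 2 * gamma ^+ 2 <= 2 * q ->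
    d <= eps * (Lam * gamma) ->
  Num.min (1 + Lh * d / c) (kappa^-1) <= (1 + G * Q) ^+ 2.
Proof.
move=> Q0 Q4 q0 gamma0 qle gle dle.
(* [P] will be [Q] or [Q ^+ 2], according to which rate is available for [sigma]; the constants of
   eta collect into [G ^+ 2]. *)
have etaP P : 0 <= P -> sigma ^+ t <= P ^+ 2 ->
    1 + Lh * d / c <= 1 + 3 / 2 * kappa * G ^+ 2 * P.
  move=> P0 sP.
  have gP : gamma <= 3 / 2 * (E / l * P).
    rewrite -ler_sqr ?nnegrE //; last by rewrite !mulr_ge0 // invr_ge0 ltW.
    rewrite -(ler_pM2l l2_gt0); apply: le_trans gle _.
    have -> : l ^+ 2 * (3 / 2 * (E / l * P)) ^+ 2 = 9 / 4 * (P ^+ 2 * E ^+ 2).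
      by field; rewrite gt_eqF.
    have := le_trans qle (ler_wpM2r (sqr_ge0 E) sP); have := sqr_ge0 (P * E).
    by rewrite exprMn; lra.
  rewrite lerD2l ler_pdivrMr //.
  have -> : 3 / 2 * kappa * G ^+ 2 * P * c =
            Lh * (eps * (Lam * (3 / 2 * (E / l * P)))).
    by rewrite G2E /kappa; field; rewrite !gt_eqF.
  rewrite ler_wpM2l //; apply: le_trans dle _; rewrite ler_wpM2l //.
  by rewrite ler_pM2l.
have GQ0 : 0 <= G * Q by rewrite mulr_ge0.
(* For small [G], the bound on [sigma ^+ 2] permits [P = Q], and eta fits into the linear term
   [2 * (G * Q)]. *)
have [small|big] := lerP (3 * kappa * G) 4.
  have : sigma ^+ t <= Q ^+ 2.
    rewrite -ler_sqr ?nnegrE ?exprn_ge0 ?sigma_ge0 // -[leRHS]exprM Q4.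
    rewrite -exprM mulnC exprM lerXn2r ?nnegrE ?sqr_ge0 //.
      by apply: le_trans sigma_sqr_le; exact: sqr_ge0.
    exact: sigma_sqr_le.
  move=> /(etaP _ Q0) h; rewrite ge_min; apply/orP; left; apply: le_trans h _.
  have := ler_wpM2r GQ0 small; have := sqr_ge0 (G * Q).
  by lra.
have : sigma ^+ t <= (Q ^+ 2) ^+ 2.
  rewrite -exprM Q4; apply: lerXn2r; rewrite ?nnegrE ?sigma_ge0 //.
    by apply: le_trans sigma_ge0 _; exact: sigma_le.
  exact: sigma_le.
move=> /(etaP _ (sqr_ge0 Q)) h; rewrite ge_min.
have := sqr_ge0 (G * Q) => GQ2.
(* Now eta is at most [3 / 2 * kappa * (G * Q) ^+ 2]. It fits into [(G * Q) ^+ 2] if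
   [kappa <= 2 / 3], and into the linear and square terms together if [G * Q <= 1]. Otherwise
   [kappa^-1] is below 3/2 while the right side exceeds 4. *)
have [kl|kg] := lerP (3 * kappa) 2.
  apply/orP; left; apply: le_trans h _.
  by have := ler_wpM2r GQ2 kl; rewrite exprMn; lra.
have [GQ1|GQ1] := lerP (G * Q) 1.
  apply/orP; left; apply: le_trans h _.
  have h1 := ler_wpM2l GQ0 GQ1; have := ler_wpM2r GQ2 l2c_le1.
  by rewrite -/kappa; lra.
apply/orP; right; rewrite -(ler_pM2l kappa_gt0) mulfV ?gt_eqF //.
have : 1 <= (1 + G * Q) ^+ 2 * (2 / 3) by nra.
have := sqr_ge0 (1 + G * Q); nra.
Qed.

End Comparison.
End StepConstants.

(** * Gap decay and the one-step estimate for the iterates *)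

Section Iteration.
Context {R : realType} {k : nat}.
Variables (F : 'cV[R]_k -> R) (g : 'cV[R]_k -> 'cV[R]_k).
Variables (D S : 'cV[R]_k -> 'M[R]_k) (B : 'M[R]_k).
Variables (a l c e Lh E eps rho G : R) (K : nat).
Variables (ystar : 'cV[R]_k) (y : nat -> 'cV[R]_k).

Let H x : 'M[R]_k := D x - B.
Let Lam : R := (\sum_(0 <= j < K.+1) rho ^+ j) / c.
Let T x : 'M[R]_k := invmx (S x).
Let P x : 'M[R]_k :=
  T x *m (\sum_(0 <= j < K.+1) (T x *m B *m T x) ^+ j) *m T x.
Let zeta : R := (2 - eps) * eps * (a * l ^+ 2)
  - eps * (Lh * eps ^+ 2 * Lam ^+ 3 * E / (6 * l ^+ 3)).

Hypotheses
  (F_line : forall x d (t : R),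
     is_derive t (1 : R) (fun u => F (x + u *: d)) (dot (g (x + t *: d)) d))
  (g_line : forall x d v (t : R),
     is_derive t (1 : R) (fun u => dot v (g (x + u *: d)))
       (dot v (H (x + t *: d) *m d))).
Hypotheses (a_gt0 : 0 < a) (l_gt0 : 0 < l) (c_gt0 : 0 < c) (e_ge0 : 0 <= e)
  (Lh_ge0 : 0 <= Lh) (E_ge0 : 0 <= E) (eps01 : 0 <= eps <= 1)
  (rho_ge0 : 0 <= rho) (G_ge0 : 0 <= G)
  (l2c_le1 : l ^+ 2 * c <= 1) (ae_le : (a + e) * l ^+ 2 <= 1)
  (eps_le : eps ^+ 2 * Lh * Lam ^+ 3 * E <= 3 * a * l ^+ 5)
  (G2E : G ^+ 2 = Lh * eps * Lam * E / (l ^+ 3 * c ^+ 2)).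
Hypotheses (ST : forall x, (S x)^T = S x) (SU : forall x, S x \in unitmx)
  (SS : forall x, S x *m S x = D x).
Hypotheses
  (D_ge : forall x v, c * dot v v <= dot v (D x *m v))
  (D_le : forall x v, l ^+ 2 * dot v (D x *m v) <= dot v v)
  (BT : B^T = B) (B_psd : forall v, 0 <= dot v (B *m v))
  (B_le : forall x v, dot v (B *m v) <= rho * dot v (D x *m v))
  (H_ge : forall x v, a * dot v v <= dot v (H x *m v))
  (D_var : forall x x' v, dot v (D x' *m v) <= dot v (D x *m v) + e * dot v v)
  (D_Lip : forall x x' v w, dot v (D x' *m w) <=
     dot v (D x *m w) + Lh * enorm (x' - x) * (enorm v * enorm w)).
Hypotheses (ystar_argmin : forall z, F ystar <= F z)
  (E2E : E ^+ 2 = F (y 0%N) - F ystar)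
  (y_iter : forall t, y t.+1 = y t - eps *: (P (y t) *m g (y t))).

Let gap t : R := F (y t) - F ystar.
Let s t : R := dot (g (y t)) (P (y t) *m g (y t)).
Let N t : R := enorm (P (y t) *m g (y t)).
Let gamma t : R := enorm (g (y t)).
Let d t : 'cV[R]_k := - (eps *: (P (y t) *m g (y t))).

Let l2_gt0 : 0 < l ^+ 2. Proof. exact: exprn_gt0. Qed.

Let eps_ge0 : 0 <= eps. Proof. by case/andP: eps01. Qed.

Let gap_ge0 t : 0 <= gap t. Proof. by rewrite subr_ge0. Qed.

Let Lam_ge : 1 <= Lam * c.
Proof.
rewrite divfK ?gt_eqF // big_nat_recl // expr0 lerDl.
by apply: sumr_ge0 => j _; rewrite exprn_ge0.
Qed.

Let Lam_ge0 : 0 <= Lam.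
Proof. by rewrite -(pmulr_lge0 _ c_gt0) (le_trans ler01). Qed.

Let H_le x v : dot v (H x *m v) <= (l ^+ 2)^-1 * dot v v.
Proof.
rewrite mulrC ler_pdivlMr // mulrC; apply: le_trans (D_le x v).
by rewrite ler_pM2l // mulmxBl dotBr gerBl.
Qed.

Let H_var x x' v : dot v (H x' *m v) <= dot v (H x *m v) + e * dot v v.
Proof. by rewrite !mulmxBl !dotBr addrAC lerD2r. Qed.

Let H_Lip x x' v w : dot v (H x' *m w) <=
  dot v (H x *m w) + Lh * enorm (x' - x) * (enorm v * enorm w).
Proof. by rewrite !mulmxBl !dotBr addrAC lerD2r. Qed.

Let yE t : y t.+1 = y t + d t. Proof. exact: y_iter. Qed.

Let dE t : enorm (d t) = eps * N t.
Proof. by rewrite /d -scaleNr enormZ normrN ger0_norm. Qed.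

Let dot_gd t : dot (g (y t)) (d t) = - (eps * s t).
Proof. by rewrite dotNr dotZr. Qed.

Let dot_dHd t : dot (d t) (H (y t) *m d t) <= eps ^+ 2 * s t.
Proof.
rewrite /d mulmxN -scalemxAr dotNl dotNr opprK dotZl dotZr mulrA -expr2.
by rewrite ler_wpM2l ?sqr_ge0 //; exact: hessian_NN_le.
Qed.

Let N_le t : N t <= Lam * gamma t.
Proof. exact: (NN_le (D := D (y t))). Qed.

Let N2_le t : N t ^+ 2 <= Lam * s t.
Proof. exact: (NN_sqr_le (D := D (y t))). Qed.

Let s_ge t : l ^+ 2 * gamma t ^+ 2 <= s t.
Proof. by rewrite sqr_enorm; exact: (dot_NN_ge (D := D (y t))). Qed.

Let gamma_le t : l ^+ 2 * gamma t ^+ 2 <= 2 * gap t.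
Proof.
have := sqr_enorm_grad_le F_line g_line H_le ystar_argmin (y t).
rewrite invr_gt0 => /(_ l2_gt0).
by move=> h; rewrite -ler_pdivlMl // mulrA [_^-1 * 2]mulrC.
Qed.

Let gamma_ge t : 2 * a * gap t <= gamma t ^+ 2.
Proof. exact: (sqr_enorm_grad_ge F_line g_line H_ge ystar (y t) a_gt0). Qed.

Let cubic t : gap t.+1 <=
  gap t - eps * s t + eps ^+ 2 * s t / 2 + Lh * (eps * N t) ^+ 3 / 6.
Proof.
rewrite /gap yE; have := taylor_cubic F_line g_line H_Lip (y t) (d t).
by rewrite dot_gd dE; have := dot_dHd t; lra.
Qed.

Let variation t : gap t.+1 <=
  gap t - eps * s t + eps ^+ 2 * s t / 2 + e * (eps * N t) ^+ 2 / 2.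
Proof.
rewrite /gap yE; have := taylor_variation F_line g_line (y t) (d t) H_var.
by rewrite dot_gd dE; have := dot_dHd t; lra.
Qed.

Let sigma : R := decrease_factor (a * l ^+ 2) eps (Num.min
  (3 / 2 * (Lh * eps ^+ 2 * Lam ^+ 3 * E / (6 * l ^+ 3)) * l ^+ 2 / Lam)
  (e * eps * Lam / 2)).

Let gap_le t : gap t <= sigma ^+ t * E ^+ 2.
Proof.
have s0 : 0 <= sigma by exact: (sigma_ge0 (c := c)).
have s1 : sigma <= 1 by exact: (sigma_le1 (c := c)).
elim: t => [|t IH]; first by rewrite mul1r E2E.
rewrite exprS -mulrA; apply: le_trans (ler_wpM2l s0 IH).
(* Since [sigma <= 1], the gap has not grown, so the gradient is still controlled by the initial
   gap, as [descent_step] requires. *)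
have gE : gamma t <= 3 / 2 * (E / l).
  have El : 0 <= 3 / 2 * (E / l) by rewrite mulr_ge0 // divr_ge0 // ltW.
  rewrite -ler_sqr ?nnegrE ?enorm_ge0 // -(ler_pM2l l2_gt0).
  have -> : l ^+ 2 * (3 / 2 * (E / l)) ^+ 2 = 9 / 4 * E ^+ 2.
    by field; rewrite gt_eqF.
  have : sigma ^+ t * E ^+ 2 <= E ^+ 2.
    by rewrite ler_piMl ?sqr_ge0 // exprn_ile1.
  by have := gamma_le t; have := IH; have := sqr_ge0 E; lra.
exact: (descent_step a_gt0 l_gt0 c_gt0 e_ge0 Lh_ge0 E_ge0 eps01 Lam_ge ae_le
  eps_le (enorm_ge0 _) gE (N_le t) (N2_le t) (s_ge t) (gamma_ge t) (cubic t)
  (variation t)).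
Qed.

Lemma enorm_invmx_next_le t Q : 0 <= Q -> Q ^+ 4 = (1 - zeta) ^+ t ->
  enorm (T (y t.+1) *m g (y t.+1)) <=
  (1 + G * Q) * enorm (T (y t) *m g (y t.+1)).
Proof.
move=> Q0 Q4; set h := g (y t.+1).
have GQ : 0 <= 1 + G * Q by rewrite addr_ge0 // mulr_ge0.
have d_le : enorm (d t) <= eps * (Lam * gamma t).
  by rewrite dE ler_wpM2l.
have := comparison_factor a_gt0 l_gt0 c_gt0 e_ge0 Lh_ge0 E_ge0 eps01 l2c_le1
  Lam_ge ae_le G_ge0 G2E Q0 Q4 (gap_ge0 t) (enorm_ge0 _) (gap_le t)
  (gamma_le t) d_le.
set m := Num.min _ _ => m_le.
have m0 : 0 <= m.
  rewrite le_min invr_ge0 !(mulr_ge0 (ltW _) (ltW _)) // andbT addr_ge0 //.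
  by rewrite divr_ge0 ?(ltW c_gt0) // mulr_ge0 ?enorm_ge0.
apply: enorm_le; first by rewrite mulr_ge0 ?enorm_ge0.
rewrite exprMn sqr_enorm; apply: le_trans (ler_wpM2r (dot_ge0 _) m_le).
apply: (@invmx_compare _ _ (S (y t.+1)) (D (y t.+1)) _ _ _ _ (D (y t))) => // v.
have Dv : c * dot v v <= dot v (D (y t.+1) *m v) by [].
have Dv0 : 0 <= dot v (D (y t.+1) *m v).
  by apply: le_trans Dv; rewrite mulr_ge0 ?dot_ge0 // ltW.
(* The first entry uses the Lipschitz bound and [D_ge]; the second passes through a multiple of the
   identity by [D_le] and [D_ge]. *)
rewrite /m /Num.min; case: ifP => _.
  apply: le_trans (D_Lip (y t.+1) (y t) v v) _.
  rewrite mulrDl mul1r lerD2l -expr2 sqr_enorm.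
  have -> : enorm (y t - y t.+1) = enorm (d t).
    rewrite yE opprD addrA subrr add0r -scaleN1r enormZ normrN normr1.
    by rewrite mul1r.
  rewrite [leRHS]mulrAC ler_pdivlMr // -!mulrA ler_wpM2l //.
  rewrite ler_wpM2l ?enorm_ge0 //.
  by rewrite mulrC.
apply: le_trans (_ : (l ^+ 2)^-1 * dot v v <= _).
  by rewrite mulrC ler_pdivlMr // mulrC.
rewrite [(l ^+ 2 * c)^-1]invfM -[leRHS]mulrA.
rewrite ler_wpM2l ?invr_ge0 ?(ltW l2_gt0) //.
by rewrite mulrC ler_pdivlMr // mulrC.
Qed.

Theorem enorm_invmx_step t Q : 0 <= Q -> Q ^+ 4 = (1 - zeta) ^+ t ->
  enorm (T (y t.+1) *m g (y t.+2)) <=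
  (1 - eps + eps * rho ^+ K.+1) * (1 + G * Q) * enorm (T (y t) *m g (y t.+1))
  + eps ^+ 2 * (Lh * Lam ^+ 2 / (2 * l ^+ 2 * Num.sqrt c))
    * enorm (T (y t) *m g (y t.+1)) ^+ 2.
Proof.
move=> Q0 Q4; set h := g (y t.+1); set x := y t.+1.
(* The gradient splits into its linear prediction, handled by [NN_contraction], and this Taylor
   remainder. *)
set res := g (x + d t.+1) - h - H x *m d t.+1.
have -> : g (y t.+2) = (h - eps *: (H x *m (P x *m h))) + res.
  have -> : res = g (y t.+2) - h + eps *: (H x *m (P x *m h)).
    by rewrite /res yE {2}/d mulmxN -scalemxAr opprK.
  by rewrite addrCA subrK subrK.
rewrite mulmxDr; apply: le_trans (enormD _ _) _; apply: lerD.
  rewrite -[leRHS]mulrA; apply: le_trans (NN_contraction K (ST x) (SU x) (SS x)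
    BT rho_ge0 B_psd (B_le x) h eps01) _.
  rewrite ler_wpM2l ?enorm_invmx_next_le //.
  by rewrite addr_ge0 ?mulr_ge0 ?exprn_ge0 // subr_ge0; case/andP: eps01.
(* The constant Gamma2 is assembled from [T x], which costs [1 / sqrt c], the remainder, quadratic
   in a step of size at most [eps * Lam * gamma], and the passage from [gamma] to the scaled
   gradient, which costs [1 / l ^+ 2] after squaring. *)
have sc_gt0 : 0 < Num.sqrt c by rewrite sqrtr_gt0.
have Tres : Num.sqrt c * enorm (T x *m res) <= enorm res.
  rewrite -ler_sqr ?nnegrE ?mulr_ge0 ?enorm_ge0 ?(ltW sc_gt0) // exprMn.
  rewrite sqr_sqrtr ?(ltW c_gt0) // !sqr_enorm.
  exact: (enorm_invmx_sqr_le (ST x) (SU x) (SS x) (D_ge x)).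
have res_le : enorm res <= Lh / 2 * (eps * (Lam * gamma t.+1)) ^+ 2.
  apply: le_trans (grad_taylor g_line Lh_ge0 H_Lip x (d t.+1)) _.
  have N0 : 0 <= eps * N t.+1 by rewrite mulr_ge0 ?enorm_ge0.
  have N_le' : eps * N t.+1 <= eps * (Lam * gamma t.+1) by rewrite ler_wpM2l.
  by rewrite dE ler_wpM2l ?divr_ge0 // ler_sqr ?nnegrE // (le_trans N0).
have gamma_T : l ^+ 2 * gamma t.+1 ^+ 2 <= enorm (T (y t) *m h) ^+ 2.
  rewrite !sqr_enorm.
  exact: (enorm_invmx_sqr_ge (ST (y t)) (SU (y t)) (SS (y t)) (D_le (y t))).
rewrite -(ler_pM2l sc_gt0); apply: le_trans Tres _; apply: le_trans res_le _.
set u := enorm _ ^+ 2 in gamma_T *.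
have -> : Num.sqrt c *
    (eps ^+ 2 * (Lh * Lam ^+ 2 / (2 * l ^+ 2 * Num.sqrt c)) * u) =
    eps ^+ 2 * Lam ^+ 2 * Lh / 2 * (u / l ^+ 2).
  by field; rewrite !gt_eqF.
have -> : Lh / 2 * (eps * (Lam * gamma t.+1)) ^+ 2 =
   eps ^+ 2 * Lam ^+ 2 * Lh / 2 * gamma t.+1 ^+ 2 by rewrite !exprMn; lra.
rewrite ler_wpM2l //; last by rewrite ler_pdivlMr // mulrC.
by rewrite divr_ge0 // mulr_ge0 // -exprMn sqr_ge0.
Qed.

End Iteration.

(** * Existence of positive semidefinite square roots *)

Section SquareRoot.
Context {R : realType}.

Lemma interpolation (F : fieldType) (s : seq F) (h : F -> F) :
  exists q : {poly F}, forall x, x \in s -> q.[x] = h x.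
Proof.
elim: s => [|x s [q qE]]; first by exists 0.
have [xs|xs] := boolP (x \in s).
  by exists q => z; rewrite inE => /orP[/eqP->|]; exact: qE.
pose r : {poly F} := \prod_(z <- s) ('X - z%:P).
have rx : r.[x] != 0 by rewrite -[_ == 0]/(root r x) root_prod_XsubC.
exists (q + ((h x - q.[x]) / r.[x]) *: r) => z; rewrite inE !hornerE.
case/orP => [/eqP->|zs]; first by rewrite divfK // addrC subrK.
have /eqP -> : r.[z] == 0 by rewrite -[_ == 0]/(root r z) root_prod_XsubC.
by rewrite mulr0 addr0 qE.
Qed.

Lemma trmx_horner d (A : 'M[R]_d.+1) (q : {poly R}) : A^T = A ->
  (horner_mx A q)^T = horner_mx A q.
Proof.
move=> AT; elim/poly_ind: q => [|q b IH]; first by rewrite rmorph0 trmx0.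
rewrite rmorphD rmorphM /= horner_mx_X horner_mx_C linearD /= tr_scalar_mx.
rewrite trmx_mul IH AT; congr (_ + _).
have -> : A *m horner_mx A q = horner_mx A ('X * q).
  by rewrite rmorphM /= horner_mx_X.
by rewrite mulrC rmorphM /= horner_mx_X.
Qed.

(** Over the complex numbers [A] is Hermitian, hence unitarily diagonalizable, and [s] lists its
    eigenvalues. Phrasing the result by annihilating real polynomials brings the conclusion back to
    the reals. *)
Lemma psd_spectrum d (A : 'M[R]_d.+1) : psdmx A ->
  exists2 s : seq R, (forall x, x \in s -> 0 <= x) &
    forall q : {poly R}, (forall x, x \in s -> q.[x] = 0) -> horner_mx A q = 0.
Proof.
move=> [AT Apsd]; pose phi := real_complex R.
pose Ac := map_mx phi A.
have Ac_herm : Ac \is hermsymmx.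
  apply: realsym_hermsym.
    apply/is_hermitianmxP; rewrite expr0 scale1r; apply/matrixP => i j.
    by rewrite !mxE -[in LHS]AT mxE.
  by apply/mxOverP => i j; rewrite mxE; apply/complex_realP; exists (A i j).
have /hermitian_normalmx /orthomx_spectralP AcE := Ac_herm.
have sp_real := hermitian_spectral_diag_real Ac_herm.
set P := spectralmx Ac in AcE; set sp := spectral_diag Ac in AcE sp_real.
have PU : P \in unitmx by exact: spectral_unit.
pose mu i : R := complex.Re (sp 0 i).
have spE i : sp 0 i = phi (mu i).
  by rewrite /phi /mu RRe_real //; exact: (mxOverP sp_real).
exists [seq mu i | i <- enum 'I_d.+1] => [_ /mapP[i _ ->]|q q0].
  have : eigenvalue Ac (phi (mu i)).
    apply/eigenvalueP; exists (row i P).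
      rewrite {1}AcE -row_mul !mulmxA mulmxV // mul1mx row_mul row_diag_mx.
      by rewrite -scalemxAl -rowE spE.
    apply/eqP => /(congr1 (mulmx^~ (invmx P))); rewrite rowE mulmxK // mul0mx.
    by move=> /rowP/(_ i); rewrite !mxE !eqxx => /eqP; rewrite oner_eq0.
  (* A real eigenvalue of the complexified matrix has a real eigenvector, on which the form of [A]
     shows its sign. *)
  rewrite eigenvalue_map => /eigenvalueP[v vA v0].
  have : 0 <= mu i * dot v^T v^T.
    rewrite -dotZr; have := Apsd v^T; rewrite dot_mulmxE.
    by rewrite -{1}AT -trmx_mul vA linearZ.
  rewrite pmulr_lge0 // lt0r dot_ge0 andbT; apply: contra v0 => /eqP vv0.
  have /enorm_eq0P/(congr1 trmx) : enorm v^T = 0 by rewrite enormE vv0 sqrtr0.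
  by rewrite trmxK trmx0 => ->.
apply: (map_mx_inj (f := phi)); rewrite map_mx0 map_horner_mx -/Ac AcE.
rewrite horner_mx_uconjC // horner_mx_diag.
have -> : map_mx (horner (map_poly phi q)) sp = 0.
  apply/rowP => i; rewrite !mxE spE horner_map q0 ?rmorph0 //.
  by apply: map_f; rewrite mem_enum.
by rewrite linear0 mulmx0 mul0mx.
Qed.

(* With q interpolating the fourth roots of the eigenvalues, q(A)^2 is a square
   root of A, and it is positive semidefinite because q(A) is symmetric. *)
Theorem psd_sqrtmx d (A : 'M[R]_d) : psdmx A ->
  psdmx (sqrtmx A) /\ sqrtmx A *m sqrtmx A = A.
Proof.
move=> Apsd; rewrite /sqrtmx.
suff : exists S : 'M[R]_d, psdmx S /\ S *m S = A.
  by move=> [S SA]; case: xgetP => [_ -> []|/(_ S)].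
case: d A Apsd => [A _|d A Apsd].
  exists 0; split; last by apply/matrixP => -[].
  by split=> [|v]; [rewrite trmx0|rewrite mulmx0 mul0mx mxE].
have [s s0 sA] := psd_spectrum Apsd.
have [q qE] := interpolation s (fun x => Num.sqrt (Num.sqrt x)).
have QT := trmx_horner q Apsd.1; set Q := horner_mx A q in QT.
exists (Q *m Q); split.
  split=> [|v]; first by rewrite trmx_mul QT.
  by rewrite dot_mulmxE -mulmxA dot_sym // dot_ge0.
apply/eqP; rewrite -subr_eq0.
have -> : Q *m Q *m (Q *m Q) - A = horner_mx A (q * q * (q * q) - 'X).
  by rewrite rmorphB !rmorphM /= horner_mx_X.
apply/eqP/sA => x xs; rewrite !(hornerD, hornerN, hornerM, hornerX) !qE //.
have yy (z : R) : 0 <= z -> Num.sqrt z * Num.sqrt z = z.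
  by rewrite -expr2; exact: sqr_sqrtr.
by rewrite yy ?sqrtr_ge0 // yy ?s0 // subrr.
Qed.

End SquareRoot.

(** * Real powers, the stepsize rule and degenerate cases *)

Lemma powR_half (R : realType) (x : R) k : 0 <= x ->
  x `^ (k%:R / 2) = Num.sqrt x ^+ k.
Proof.
by move=> x0; rewrite mulrC powRrM powR12_sqrt // powR_mulrn // sqrtr_ge0.
Qed.

Lemma powR_divn_exp (R : realType) (x r : R) k : (0 < k)%N ->
  (x `^ (r / k%:R)) ^+ k = x `^ r.
Proof.
by move=> k0; rewrite -powR_mulrn ?powR_ge0 // -powRrM divfK // pnatr_eq0 -lt0n.
Qed.

(** With the denominator cleared, the bound also covers the branch where it vanishes and the
    stepsize is 1. *)
Lemma stepsize_bounds (R : realType) (m L lambda Lambda gap : R) :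
    0 <= m -> 0 <= L -> 0 <= lambda -> 0 <= Lambda -> 0 <= gap ->
  let eps := stepsize m L lambda Lambda gap in
  0 <= eps <= 1 /\
  eps ^+ 2 * (L * Lambda ^+ 3 * Num.sqrt gap) <= 3 * m * Num.sqrt lambda ^+ 5.
Proof.
move=> m0 L0 lambda0 Lambda0 gap0 /=; rewrite /stepsize.
have -> : gap `^ (1 / 2) = Num.sqrt gap by rewrite -[RHS]expr1 -powR_half.
rewrite powR_half //; set den := L * _ * _; set num := 3 * m * _.
have num0 : 0 <= num by rewrite mulr_ge0 ?exprn_ge0 ?sqrtr_ge0 // mulr_ge0.
have den0 : 0 <= den.
  by rewrite mulr_ge0 ?sqrtr_ge0 // mulr_ge0 ?exprn_ge0.
case: eqVneq => [->|den_neq0]; first by rewrite mulr0 ler01 lexx.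
have den_gt0 : 0 < den by rewrite lt_neqAle eq_sym den_neq0.
set x := _ `^ _; have x0 : 0 <= x by exact: powR_ge0.
have x2 : x ^+ 2 = num / den.
  by rewrite powR_divn_exp // powRr1 // divr_ge0.
split; first by rewrite le_min ler01 x0 ge_min lexx.
rewrite -ler_pdivlMr // -x2 ler_sqr ?nnegrE ?le_min ?ler01 //.
by rewrite ge_min lexx orbT.
Qed.

Lemma posdef_unitmx (R : realType) d (S D : 'M[R]_d) c : 0 < c ->
  S^T = S -> S *m S = D -> (forall v, c * dot v v <= dot v (D *m v)) ->
  S \in unitmx.
Proof.
move=> c0 ST SS D_ge; rewrite unitmxE unitfE; apply/negP => /det0P[v v0 vS].
have Sv : S *m v^T = 0 by rewrite -{1}ST -trmx_mul vS trmx0.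
have := D_ge v^T; rewrite -SS -mulmxA Sv mulmx0 dot0r pmulr_rle0 // => vv.
have vv0 : dot v^T v^T = 0 by apply/eqP; rewrite eq_le vv dot_ge0.
have /enorm_eq0P/(congr1 trmx) : enorm v^T = 0 by rewrite enormE vv0 sqrtr0.
by rewrite trmxK trmx0 => v_eq0; rewrite v_eq0 eqxx in v0.
Qed.

Lemma enorm_dim0 (R : realType) d (v : 'cV[R]_d) : d = 0%N -> enorm v = 0.
Proof.
by move=> d0; move: v; rewrite d0 => v; rewrite /enorm big_ord0 sqrtr0.
Qed.

Lemma Lipschitz_constant_ge0 (R : realType) p (A : 'cV[R]_p -> 'M[R]_p) L :
    (0 < p)%N ->
    (forall x x', specnorm (A x - A x') <= L * enorm (x - x')) ->
  0 <= L.
Proof.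
case: p A => // p A _ AL; pose x : 'cV[R]_p.+1 := delta_mx 0 0.
have x_gt0 : 0 < enorm (x - 0).
  rewrite lt_neqAle enorm_ge0 andbT eq_sym; apply/eqP => /enorm_eq0P.
  by move=> /colP/(_ 0); rewrite !mxE /= subr0 => /eqP; rewrite oner_eq0.
by rewrite -(pmulr_lge0 _ x_gt0); apply: le_trans (AL x 0); exact: specnorm_ge0.
Qed.

(** * The abstract iteration applied to the network objective *)

Theorem lemma2 (R : realType) (n p K : nat)
  (N : 'I_n -> {set 'I_n}) (W : 'M[R]_n)
  (f : 'I_n -> 'cV[R]_p -> R)
  (alpha delta Delta m M L : R)
  (rho lambda Lambda epsilon zeta Gamma1 Gamma2 gap : R)
  (ystar : 'cV[R]_(n * p)) (y : nat -> 'cV[R]_(n * p))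
  (N_connected : connected_network N)
  (W_weights : network_weights N W)
  (alpha_gt0 : 0 < alpha)
  (f_strongly_convex : forall i, strongly_convex (f i))
  (ystar_argmin : forall z, Fobj W alpha f ystar <= Fobj W alpha f z)
  (delta_bounds : 0 <= delta <= Delta /\ Delta < 1)
  (W_diag : forall i, delta <= W i i <= Delta)
  (f_twice_diff : forall i, twice_differentiable (f i))
  (mM_bounds : 0 < m <= M)
  (hessian_bounds : forall i x,
     loewner m%:M (hessian (f i) x) /\ loewner (hessian (f i) x) M%:M)
  (hessian_Lipschitz : forall i x x',
     specnorm (hessian (f i) x - hessian (f i) x') <= L * enorm (x - x'))
  (gapE : gap = Fobj W alpha f (y 0%N) - Fobj W alpha f ystar)
  (rhoE : rho = 2 * (1 - delta) / (2 * (1 - delta) + alpha * m))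
  (lambdaE : lambda = 1 / (2 * (1 - delta) + alpha * M))
  (LambdaE : Lambda =
     (1 - rho ^+ K.+1) / ((1 - rho) * (2 * (1 - Delta) + alpha * m)))
  (epsilonE : epsilon = stepsize m L lambda Lambda gap)
  (zetaE : zeta = (2 - epsilon) * epsilon * alpha * m * lambda
     - alpha * epsilon ^+ 3 * L * Lambda ^+ 3 * gap `^ (1 / 2)
       / (6 * lambda `^ (3 / 2)))
  (Gamma1E : Gamma1 =
     (alpha * epsilon * L * Lambda) `^ (1 / 2) * gap `^ (1 / 4)
     / (lambda `^ (3 / 4) * (2 * (1 - Delta) + alpha * m)))
  (Gamma2E : Gamma2 = alpha * L * Lambda ^+ 2
     / (2 * lambda * (2 * (1 - Delta) + alpha * m) `^ (1 / 2)))
  (y_iter : forall t, y t.+1 =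
     y t - epsilon *: (NNinv W alpha f K (y t) *m grad (Fobj W alpha f) (y t))) :
  forall t : nat, (1 <= t)%N ->
    enorm (invsqrtmx (Dmx W alpha f (y t))
           *m grad (Fobj W alpha f) (y t.+1)) <=
    (1 - epsilon + epsilon * rho ^+ K.+1)
    * (1 + Gamma1 * (1 - zeta) `^ ((t%:R - 1) / 4))
    * enorm (invsqrtmx (Dmx W alpha f (y t.-1))
             *m grad (Fobj W alpha f) (y t))
    + epsilon ^+ 2 * Gamma2
      * enorm (invsqrtmx (Dmx W alpha f (y t.-1))
               *m grad (Fobj W alpha f) (y t)) ^+ 2.
Proof.
move=> [//|t] _ /=.
(* In dimension 0 the Lipschitz hypothesis does not force [0 <= L]. *)
have [np0|np_gt0] := posnP (n * p).
  by rewrite !(enorm_dim0 _ np0) mulr0 expr0n mulr0 addr0.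
have /andP[n_gt0 p_gt0] : (0 < n)%N && (0 < p)%N by rewrite -muln_gt0.
have L_ge0 : 0 <= L.
  exact: Lipschitz_constant_ge0 p_gt0 (hessian_Lipschitz (Ordinal n_gt0)).
case: W_weights => _ WT W_ge0 W1 _.
have W_sum i : \sum_j W i j = 1.
  have /colP/(_ i) := W1; rewrite !mxE => <-.
  by apply: eq_bigr => j _; rewrite mxE mulr1.
have [/andP[delta0 dD] D1] := delta_bounds; have /andP[m0 mM] := mM_bounds.
have am_gt0 : 0 < alpha * m by rewrite mulr_gt0.
have aM : alpha * m <= alpha * M by rewrite ler_pM2l.
set c : R := 2 * (1 - Delta) + alpha * m.
set U : R := 2 * (1 - delta) + alpha * M.
have c_gt0 : 0 < c by rewrite /c; lra.
have cU : c <= U by rewrite /c /U; lra.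
have U_gt0 : 0 < U by apply: lt_le_trans cU.
have {}lambdaE : lambda = U^-1 by rewrite lambdaE div1r.
have lambda_gt0 : 0 < lambda by rewrite lambdaE invr_gt0.
pose l : R := Num.sqrt lambda.
have l_gt0 : 0 < l by rewrite sqrtr_gt0.
have l2 : l ^+ 2 = lambda by rewrite sqr_sqrtr // ltW.
have gap_ge0 : 0 <= gap by rewrite gapE subr_ge0.
pose E : R := Num.sqrt gap.
have gap_half : gap `^ (1 / 2) = E by rewrite -[RHS]expr1 -powR_half.
have rho_den : 0 < 2 * (1 - delta) + alpha * m by lra.
have rho_ge0 : 0 <= rho by rewrite rhoE divr_ge0 ?(ltW rho_den) //; lra.
have rho_lt1 : rho < 1 by rewrite rhoE ltr_pdivrMr // mul1r ltrDl.
have {}LambdaE : Lambda = (\sum_(0 <= j < K.+1) rho ^+ j) / c.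
  rewrite LambdaE -/c invfM mulrA; congr (_ / _).
  rewrite -opprB subrX1 -[1 - rho]opprB big_mkord invrN mulrNN.
  by rewrite mulrC mulKf // subr_eq0 lt_eqF.
have Lambda_ge0 : 0 <= Lambda.
  rewrite LambdaE divr_ge0 ?(ltW c_gt0) // sumr_ge0 // => j _.
  exact: exprn_ge0.
have [eps01 eps_le] :=
  stepsize_bounds (ltW m0) L_ge0 (ltW lambda_gt0) Lambda_ge0 gap_ge0.
rewrite -epsilonE in eps01 eps_le.
have eps_ge0 : 0 <= epsilon by case/andP: eps01.
pose D := Dmx W alpha f; pose S x := sqrtmx (D x).
have D_ge x v : c * dot v v <= dot v (D x *m v).
  exact: Dmx_ge W_diag alpha_gt0 hessian_bounds x v.
have DT x : (D x)^T = D x by exact: Dmx_sym W alpha _ _ _ hessian_bounds x.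
have D_psd x : psdmx (D x).
  split=> // v; rewrite dot_mulmxE; apply: le_trans (D_ge x v).
  by rewrite mulr_ge0 ?dot_ge0 // ltW.
have S_psd x := (psd_sqrtmx (D_psd x)).1.
have SS x : S x *m S x = D x by exact: (psd_sqrtmx (D_psd x)).2.
have ST x : (S x)^T = S x by exact: (S_psd x).1.
have SU x : S x \in unitmx by exact: posdef_unitmx c_gt0 (ST x) (SS x) (D_ge x).
have zetaE' : zeta = (2 - epsilon) * epsilon * (alpha * m * l ^+ 2)
  - epsilon * (alpha * L * epsilon ^+ 2 * Lambda ^+ 3 * E / (6 * l ^+ 3)).
  rewrite zetaE l2 powR_half ?(ltW lambda_gt0) //.
  by rewrite gap_half -/l; field; rewrite gt_eqF.
have quarter (x r : R) : (x `^ (r / 4)) ^+ 2 = x `^ (r / 2).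
  rewrite -powR_mulrn ?powR_ge0 // -powRrM; congr (_ `^ _).
  by field.
have Lh_ge0 : 0 <= alpha * L by rewrite mulr_ge0 ?(ltW alpha_gt0).
have e_ge0 : 0 <= alpha * (M - m).
  by rewrite mulr_ge0 ?(ltW alpha_gt0) ?subr_ge0.
have l2c_le1 : l ^+ 2 * c <= 1 by rewrite l2 lambdaE mulrC ler_pdivrMr // mul1r.
have ae_le : (alpha * m + alpha * (M - m)) * l ^+ 2 <= 1.
  by rewrite l2 lambdaE ler_pdivrMr // mul1r /U; lra.
have {}eps_le : epsilon ^+ 2 * (alpha * L) * Lambda ^+ 3 * E <=
                3 * (alpha * m) * l ^+ 5.
  by have := ler_wpM2l (ltW alpha_gt0) eps_le; rewrite -/l -/E; lra.
have Gamma1_ge0 : 0 <= Gamma1.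
  by rewrite Gamma1E divr_ge0 ?mulr_ge0 ?powR_ge0 // ltW.
have Gamma1_sqr : Gamma1 ^+ 2 =
    alpha * L * epsilon * Lambda * E / (l ^+ 3 * c ^+ 2).
  rewrite Gamma1E -/c.
  have : (alpha * epsilon * L * Lambda) `^ (1 / 2) ^+ 2 =
         alpha * epsilon * L * Lambda.
    rewrite powR_divn_exp // powRr1 //.
    by rewrite mulr_ge0 // mulr_ge0 // mulr_ge0 // ltW.
  have := quarter gap 1; rewrite gap_half.
  have := quarter lambda 3%:R; rewrite powR_half ?(ltW lambda_gt0) // -/l.
  move: (_ `^ _) (_ `^ _) (_ `^ _) => q3 q2 q1 q3E q2E q1E.
  by rewrite exprMn exprVn !exprMn q3E q2E q1E; field; rewrite !gt_eqF.
have Lambda_c : 1 <= Lambda * c.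
  rewrite LambdaE divfK ?gt_eqF // big_nat_recl // expr0 lerDl.
  by apply: sumr_ge0 => j _; rewrite exprn_ge0.
(* [1 - zeta] bounds a square from above; its sign makes the real power [Q] a genuine fourth
   root. *)
have zeta_le1 : 0 <= 1 - zeta.
  rewrite zetaE'; apply: le_trans (sqr_ge0 _) (sigma_sqr_le am_gt0 l_gt0 c_gt0
    e_ge0 Lh_ge0 (sqrtr_ge0 _) eps01 Lambda_c ae_le).
set Q := (1 - zeta) `^ _.
(* The iteration index has been shifted to [t.+1], so the exponent [t.+1 - 1] is [t]. *)
have Q4 : Q ^+ 4 = (1 - zeta) ^+ t.
  by rewrite powR_divn_exp // -powR_mulrn // -natr1 addrK.
have Gamma2E' : Gamma2 = alpha * L * Lambda ^+ 2 / (2 * l ^+ 2 * Num.sqrt c).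
  rewrite Gamma2E l2 -/c; congr (_ / (_ * _)).
  by rewrite -[RHS]expr1 -powR_half ?(ltW c_gt0).
rewrite Gamma2E'; move: Q4; rewrite zetaE' LambdaE => Q4.
apply: (@enorm_invmx_step R (n * p) (Fobj W alpha f) (grad (Fobj W alpha f)) D S
  (Bmx p W) (alpha * m) l c (alpha * (M - m)) (alpha * L) E epsilon rho Gamma1 K
  ystar y) (powR_ge0 _ _) Q4 => //.
- exact: is_derive_Fobj_line.
- exact: is_derive_grad_line hessian_bounds.
- exact: sqrtr_ge0.
- by rewrite -LambdaE.
- by rewrite -LambdaE.
- move=> x v; rewrite l2 lambdaE mulrC ler_pdivrMr // mulrC.
  exact: Dmx_le W_diag alpha_gt0 hessian_bounds x v.
- exact: Bmx_sym.
- exact: Bmx_psd.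
- move=> x v; rewrite rhoE.
  exact: (Bmx_le_Dmx WT W_ge0 W_sum W_diag alpha_gt0 m0 D1 hessian_bounds).
- exact: (hessianF_ge WT W_ge0 W_sum alpha_gt0 hessian_bounds).
- exact: (Dmx_variation W alpha_gt0 hessian_bounds).
- move=> x x' v w; rewrite -[alpha * L * _]mulrA.
  exact: (Dmx_Lipschitz W alpha_gt0 L_ge0 hessian_Lipschitz).
- by rewrite sqr_sqrtr.
Qed.
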